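(* Let $V$ be a vertex operator algebra. Assume that $V$ is $C_1$-cofinite and that there exists a positive integer $N$ such that $|\Re(n_1)-\Re(n_2)|\le N$ for the lowest weights $n_1$ and $n_2$ of any two irreducible $V$-modules and such that the associative algebra $A_N(V)$ is finite dimensional. Then any irreducible $V$-module $W$ has a projective cover in the category of finite length generalized $V$-modules.
   Context: $V=\coprod_{n\in\mathbb Z}V_{(n)}$ is a vertex operator algebra over $\mathbb C$ (with $\dim V_{(n)}<\infty$ and $V_{(n)}=0$ for $n$ sufficiently negative), $Y(u,x)=\sum_{n\in\mathbb Z}u_nx^{-n-1}$, $V_+=\coprod_{n>0}V_{(n)}$. A generalized $V$-module is a $\mathbb C$-graded space $W=\coprod_{n\in\mathbb C}W_{[n]}$ with a vertex operator map $Y_W:V\otimes W\to W((x))$ satisfying all axioms for $V$-modules except the two grading-restriction conditions (finite-dimensionality and lower truncation of the grading), and with the $L(0)$-grading property weakened to: $W_{[n]}$ is the generalized eigenspace of $L(0)$ with eigenvalue $n$. It is lower truncated if $W_{[n]}=0$ when $\Re(n)$ is sufficiently negative, grading restricted if in addition $\dim W_{[n]}<\infty$ for all $n$, and a (ordinary) $V$-module if it is grading restricted and $L(0)$ acts semisimply. Irreducible means nonzero with no proper nonzero generalized submodule. The lowest weight of a lower-truncated $W$, if it exists, is the $n_0\in\mathbb C$ with $W_{[n_0]}\neq0$ and $W_{[n]}=0$ whenever $\Re(n)<\Re(n_0)$, or $\Re(n)=\Re(n_0)$ and $n\ne n_0$; irreducible $V$-modules have lowest weights. $W$ is of length $l$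 if there are generalized submodules $W=W_1\supset\cdots\supset W_{l+1}=0$ with each $W_i/W_{i+1}$ an irreducible $V$-module; it is of finite length if it is of length $l$ for some $l$ (the zero module has length $0$). $V$ is $C_1$-cofinite (in the sense of Li) if $V/C_1(V)$ is finite dimensional, where $C_1(V)$ is spanned by $u_{-1}v$ for $u,v\in V_+$ and $L(-1)v$ for $v\in V$. For $n\in\mathbb N$, $A_n(V)=V/O_n(V)$ is the (Zhu, Dong–Li–Mason) associative algebra with product induced by $u*_nv=\sum_{m=0}^n(-1)^m\binom{m+n}{n}\mathrm{Res}_x\,x^{-n-m-1}Y((1+x)^{L(0)+n}u,x)v$, where $O_n(V)$ is spanned by $\mathrm{Res}_x\,x^{-2n-2}Y((1+x)^{L(0)+n}u,x)v$ for $u,v\in V$ and $(L(-1)+L(0))u$ for $u\in V$. For a full subcategory $\mathcal D$ of generalized $V$-modules, an object $P$ is projective in $\mathcal D$ if for any objects $W_1,W_2$, any module map $p:P\to W_2$ and surjective module map $q:W_1\to W_2$ there is a module map $\tilde p:P\to W_1$ with $q\circ\tilde p=p$. A projective cover of an object $W$ in $\mathcal D$ is a projective object $U$ of $\mathcal D$ with a surjective module map $p:U\to W$ such that for any projective object $W_1$ of $\mathcal D$ and any surjective module map $q:W_1\to W$ there is a surjective module map $\tilde q:W_1\to U$ with $p\circ\tilde q=q$. *)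

(* Defs.v *)
From HB Require Import structures.
From mathcomp Require Import all_boot all_order all_algebra generic_quotient ring_quotient.
From mathcomp Require Import complex.
From mathcomp Require Import boolp classical_sets functions cardinality fsbigop.
From mathcomp Require Import reals.

Set Implicit Arguments.
Unset Strict Implicit.
Unset Printing Implicit Defensive.

Import Order.TTheory GRing.Theory Num.Theory.
Local Open Scope classical_set_scope.
Local Open Scope ring_scope.
Local Open Scope quotient_scope.

(* Subspaces are library [submodClosed]s, i.e. boolean predicates made available
   for arbitrary subsets by classical logic. *)
Section LinearAlgebra.
Variables (K : fieldType) (M : lmodType K).

Definition lspan (A : set M) : {pred M} :=
  fun v => `[< forall S : submodClosed M, (forall a, A a -> a \in S) -> v \in S >].

Lemma lspan_submod_closed (A : set M) : submod_closed (lspan A).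
Proof.
split=> [|a u v /asboolP uA /asboolP vA]; apply/asboolP => S AS.
  exact: rpred0.
by rewrite rpredD ?rpredZ ?uA ?vA.
Qed.

HB.instance Definition _ (A : set M) :=
  GRing.isSubmodClosed.Build K M (lspan A) (lspan_submod_closed A).

Definition finite_dim (S : {pred M}) : Prop :=
  exists s : seq M, S =i lspan [set` s].

Definition direct_sum (I : choiceType) (A : I -> {pred M}) : Prop :=
  forall v : M, exists! f : I -> M,
    [/\ forall i, f i \in A i,
        finite_set [set i | f i != 0] &
        v = \sum_(i \in [set: I]) f i].

Definition gen_eigenspace (f : M -> M) (a : K) : {pred M} :=
  fun v => `[< exists k : nat, iter k (fun x => f x - a *: x) v = 0 >].

Definition binomial_coef (a : K) (i : nat) : K :=
  (\prod_(j < i) (a - j%:R)) / (i`!)%:R.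

(* The operator A (A - 1) ... (A - i + 1) / i!, i.e. the coefficient of x^i in
   (1 + x)^A; on an eigenvector of A of eigenvalue a it is [binomial_coef a i]. *)
Fixpoint binomial_op (A : M -> M) (i : nat) (v : M) : M :=
  if i is j.+1 then
    (j.+1%:R)^-1 *: (A (binomial_op A j v) - j%:R *: binomial_op A j v)
  else v.

Section Subspace.
Variable S : submodClosed M.

Definition subspace : Type := {v : M | v \in S}.
HB.instance Definition _ := SubType.on subspace.
HB.instance Definition _ := Choice.on subspace.
HB.instance Definition _ := [SubChoice_isSubLmodule of subspace by <:].

Variable T : submodClosed M.

Definition relative : {pred subspace} := fun v => val v \in T.

Lemma relative_submod_closed : submod_closed relative.
Proof.
split=> [|a u v uT vT]; rewrite /relative unfold_in /=; first exact: rpred0.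
by rewrite rpredD ?rpredZ.
Qed.

HB.instance Definition _ :=
  GRing.isSubmodClosed.Build K subspace relative relative_submod_closed.

End Subspace.

Section Quotient.
Variable S : submodClosed M.

Definition submod_zmod_pred : {pred M} := fun v => v \in S.

Lemma submod_zmod_pred_closed : zmod_closed submod_zmod_pred.
Proof. exact: (GRing.submod_closedB (GRing.submodClosedP S)). Qed.

HB.instance Definition _ :=
  GRing.isZmodClosed.Build M submod_zmod_pred submod_zmod_pred_closed.

Definition lquot : Type := Quotient.quot submod_zmod_pred.
HB.instance Definition _ := GRing.Zmodule.on lquot.
HB.instance Definition _ := Quotient.on lquot.

Definition lquot_scale (a : K) (q : lquot) : lquot := \pi_lquot (a *: repr q).

Lemma lquot_eqP (u v : M) : reflect (\pi_lquot u = \pi_lquot v) (u - v \in S).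
Proof. by rewrite (Quotient.idealrBE submod_zmod_pred); apply: eqP. Qed.

Lemma lquot_scale_pi (a : K) (v : M) :
  lquot_scale a (\pi_lquot v) = \pi_lquot (a *: v).
Proof.
rewrite /lquot_scale; apply/lquot_eqP; rewrite -scalerBr rpredZ //.
by apply/lquot_eqP; rewrite reprK.
Qed.

Lemma lquot_pi_add (u v : M) :
  \pi_lquot (u + v) = \pi_lquot u + \pi_lquot v.
Proof. exact (Quotient.pi_add submod_zmod_pred u v). Qed.

Lemma lquot_scaleA a b (q : lquot) :
  lquot_scale a (lquot_scale b q) = lquot_scale (a * b) q.
Proof. by rewrite -[q]reprK (lquot_scale_pi b (repr q)) !lquot_scale_pi scalerA. Qed.

Lemma lquot_scale1 : left_id 1 lquot_scale.
Proof. by move=> q; rewrite -[q]reprK lquot_scale_pi scale1r. Qed.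

Lemma lquot_scaleDr : right_distributive lquot_scale +%R.
Proof.
move=> a p q; rewrite -[p]reprK -[q]reprK -lquot_pi_add !lquot_scale_pi.
by rewrite scalerDr lquot_pi_add.
Qed.

Lemma lquot_scaleDl (q : lquot) :
  {morph lquot_scale^~ q : a b / a + b}.
Proof.
by move=> a b; rewrite -[q]reprK !lquot_scale_pi scalerDl lquot_pi_add.
Qed.

HB.instance Definition _ := GRing.Zmodule_isLmodule.Build K lquot
  lquot_scaleA lquot_scale1 lquot_scaleDr lquot_scaleDl.

End Quotient.
End LinearAlgebra.

(* A vertex operator map Y(u, x) = \sum_n u_n x^{-n-1} is given by its modes
   [Y u n w] = u_n w. *)
Section VertexOperatorAxioms.
Variables (R : realType) (V W : lmodType R[i]).
Implicit Types (YV : V -> int -> V -> V) (YW : V -> int -> W -> W).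

Definition bilinear_modes YW : Prop :=
  (forall n w, linear (fun u => YW u n w)) /\ (forall u n, linear (YW u n)).

Definition lower_truncation YW : Prop :=
  forall u w, exists N : int, forall n, N <= n -> YW u n w = 0.

(* The coefficient of x_0^{-l-1} x_1^{-m-1} x_2^{-n-1} in
     x_0^{-1} d((x_1 - x_2)/x_0) Y(u,x_1) Y(v,x_2) w
     - x_0^{-1} d((x_2 - x_1)/(-x_0)) Y(v,x_2) Y(u,x_1) w
     = x_2^{-1} d((x_1 - x_0)/x_2) Y(Y(u,x_0)v,x_2) w,
   d being the formal delta function; the right-hand side is expanded using
   x_2^{-1} d((x_1 - x_0)/x_2) = x_1^{-1} d((x_2 + x_0)/x_1). Each of the three
   sums has finite support by lower truncation. *)
Definition jacobi_identity YV YW : Prop :=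
  forall (u v : V) (w : W) (l m n : int),
    \sum_(i \in [set: nat])
      ((-1) ^+ i * binomial_coef (l%:~R : R[i]) i) *:
        YW u (l + m - i%:Z) (YW v (n + i%:Z) w)
    - \sum_(i \in [set: nat])
      ((-1) ^ l * (-1) ^+ i * binomial_coef (l%:~R : R[i]) i) *:
        YW v (l + n - i%:Z) (YW u (m + i%:Z) w)
    = \sum_(i \in [set: nat])
      binomial_coef (m%:~R : R[i]) i *: YW (YV u (l + i%:Z) v) (m + n - i%:Z) w.

Definition vacuum_identity YW (vac : V) : Prop :=
  forall n w, YW vac n w = if n == -1 then w else 0.

Definition virasoro_relations YW (omega : V) (c : R[i]) : Prop :=
  let L (n : int) := YW omega (n + 1) in
  forall (m n : int) (w : W),
    L m (L n w) - L n (L m w) =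
      (m - n)%:~R *: L (m + n) w
      + (if m + n == 0 then ((m ^+ 3 - m)%:~R / 12%:R * c) *: w else 0).

(* d/dx Y(u, x) = Y(L(-1)u, x), where L(-1) = omega_0. *)
Definition derivative_property YV YW (omega : V) : Prop :=
  forall (u : V) (n : int) (w : W),
    YW (YV omega 0 u) n w = - (n%:~R *: YW u (n - 1) w).

End VertexOperatorAxioms.

Record voa (R : realType) := Voa {
  voa_sort :> lmodType R[i];
  voa_gr : int -> submodClosed voa_sort;
  voa_Y : voa_sort -> int -> voa_sort -> voa_sort;
  voa_vac : voa_sort;
  voa_omega : voa_sort;
  voa_charge : R[i];
  voa_grading : direct_sum (fun n => voa_gr n);
  voa_finite_dim : forall n, finite_dim (voa_gr n);
  voa_grading_bounded :
    exists N : int, forall n v, n < N -> v \in voa_gr n -> v = 0;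
  voa_bilinear : bilinear_modes voa_Y;
  voa_truncation : lower_truncation voa_Y;
  voa_vac_gr : voa_vac \in voa_gr 0;
  voa_omega_gr : voa_omega \in voa_gr 2;
  voa_vacuum : vacuum_identity voa_Y voa_vac;
  voa_creation : forall u, voa_Y u (-1) voa_vac = u /\
                           forall n, 0 <= n -> voa_Y u n voa_vac = 0;
  voa_jacobi : jacobi_identity voa_Y voa_Y;
  voa_virasoro : virasoro_relations voa_Y voa_omega voa_charge;
  voa_L0 : forall n v, v \in voa_gr n -> voa_Y voa_omega 1 v = n%:~R *: v;
  voa_derivative : derivative_property voa_Y voa_Y voa_omega
}.

Section Modules.
Variables (R : realType) (V : voa R).

(* A space with an arbitrary family of modes, subject to no axiom; submodules
   and quotients are formed at this level. *)
Record action := Action {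
  act_sort :> lmodType R[i];
  act_Y : V -> int -> act_sort -> act_sort
}.

Definition L0 (W : action) : W -> W := @act_Y W (voa_omega V) 1.

(* The homogeneous subspace W_[n]. *)
Definition weight_space (W : action) (n : R[i]) : {pred W} :=
  gen_eigenspace (@L0 W) n.

Record is_gen_module (W : action) : Prop := IsGenModule {
  gm_grading : direct_sum (@weight_space W);
  gm_bilinear : bilinear_modes (@act_Y W);
  gm_truncation : lower_truncation (@act_Y W);
  gm_vacuum : vacuum_identity (@act_Y W) (voa_vac V);
  gm_jacobi : jacobi_identity (@voa_Y R V) (@act_Y W);
  gm_virasoro : virasoro_relations (@act_Y W) (voa_omega V) (voa_charge V);
  gm_derivative : derivative_property (@voa_Y R V) (@act_Y W) (voa_omega V)
}.

Record gen_module := GenModule {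
  gm_action :> action;
  gm_axioms : is_gen_module gm_action
}.

Definition lower_truncated (W : action) : Prop :=
  exists B : R, forall n w, complex.Re n < B -> w \in @weight_space W n -> w = 0.

Definition grading_restricted (W : action) : Prop :=
  lower_truncated W /\ forall n, finite_dim (@weight_space W n).

Definition is_module (W : action) : Prop :=
  [/\ is_gen_module W, grading_restricted W &
      forall n w, w \in @weight_space W n -> L0 w = n *: w].

Definition stable (W : action) (S : submodClosed W) : Prop :=
  forall u n w, w \in S -> act_Y u n w \in S.

Definition sub_action (W : action) (S : submodClosed W) (sS : stable S) : action :=
  @Action (subspace S) (fun u n w => Sub (act_Y u n (val w)) (sS u n _ (valP w)) : subspace S).

(* When S is stable the choice of representatives is irrelevant. *)
Definition quot_action (W : action) (S : submodClosed W) : action :=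
  @Action (lquot S) (fun u n q => \pi_(lquot S) (act_Y u n (repr q))).

Record gen_submodule (W : action) := GenSubmodule {
  gs_pred :> submodClosed W;
  gs_stable : stable gs_pred;
  gs_axioms : is_gen_module (sub_action gs_stable)
}.

(* S / T, for T contained in S. *)
Definition subquotient (W : action) (S T : gen_submodule W) : action :=
  @quot_action (sub_action (@gs_stable W S)) (relative (S := gs_pred S) (gs_pred T)).

Definition irreducible (W : action) : Prop :=
  (exists w : W, w != 0) /\
  forall S : gen_submodule W,
    (forall w, w \in S -> w = 0) \/ (forall w, w \in S).

Definition irreducible_module (W : action) : Prop := is_module W /\ irreducible W.

Definition lowest_weight (W : action) (n0 : R[i]) : Prop :=
  (exists2 w : W, w \in weight_space n0 & w != 0) /\
  forall n, complex.Re n < complex.Re n0 \/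
            (complex.Re n = complex.Re n0 /\ n != n0) ->
    forall w : W, w \in weight_space n -> w = 0.

Definition has_length (W : action) (l : nat) : Prop :=
  exists F : nat -> gen_submodule W,
    [/\ forall w, w \in F 0%N,
        forall w, w \in F l -> w = 0 &
        forall i, (i < l)%N ->
          {subset F i.+1 <= F i} /\ irreducible_module (subquotient (F i) (F i.+1))].

Definition finite_length (W : gen_module) : Prop := exists l, has_length W l.

Definition module_map (W1 W2 : action) (f : {linear W1 -> W2}) : Prop :=
  forall u n w, f (act_Y u n w) = act_Y u n (f w).

Definition surjective_map (W1 W2 : action) (f : {linear W1 -> W2}) : Prop :=
  module_map f /\ forall y, exists x, f x = y.

(* A full subcategory is given by the predicate D selecting its objects. *)
Definition projective (D : gen_module -> Prop) (P : gen_module) : Prop :=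
  D P /\
  forall (W1 W2 : gen_module) (p : {linear P -> W2}) (q : {linear W1 -> W2}),
    D W1 -> D W2 -> module_map p -> surjective_map q ->
    exists2 p' : {linear P -> W1}, module_map p' & forall x, q (p' x) = p x.

Definition projective_cover (D : gen_module -> Prop) (W U : gen_module)
    (p : {linear U -> W}) : Prop :=
  [/\ D W, projective D U, surjective_map p &
      forall (W1 : gen_module) (q : {linear W1 -> W}),
        projective D W1 -> surjective_map q ->
        exists2 q' : {linear W1 -> U}, surjective_map q' & forall x, p (q' x) = q x].

Definition has_projective_cover (D : gen_module -> Prop) (W : gen_module) : Prop :=
  exists (U : gen_module) (p : {linear U -> W}), projective_cover D p.

End Modules.

Section CofinitenessAndZhu.
Variables (R : realType) (V : voa R).
Local Notation omega := (voa_omega V).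

Definition V_plus : {pred V} :=
  lspan [set v : V | exists2 n : int, 0 < n & v \in voa_gr V n].

Definition C1_space : submodClosed V :=
  lspan ([set w : V | exists u v, [/\ u \in V_plus, v \in V_plus &
                                     w = voa_Y u (-1) v]]
         `|` [set w : V | exists v, w = voa_Y omega 0 v]).

Definition C1_cofinite : Prop := finite_dim [pred _ : lquot C1_space | true].

(* Res_x x^{-a} Y((1+x)^{L(0)+n} u, x) v
   = \sum_{i >= 0} (binomial(L(0)+n, i) u)_{i-a} v, a finite sum. *)
Definition zhu_residue (a n : nat) (u v : V) : V :=
  \sum_(i \in [set: nat])
    voa_Y (binomial_op (fun x : V => voa_Y omega 1 x + n%:R *: x) i u)
          (i%:Z - a%:Z) v.

Definition zhu_star (n : nat) (u v : V) : V :=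
  \sum_(0 <= m < n.+1)
    ((-1) ^+ m * 'C(m + n, n)%:R) *: zhu_residue (n + m + 1) n u v.

Definition zhu_O (n : nat) : submodClosed V :=
  lspan ([set w : V | exists u v, w = zhu_residue (2 * n + 2) n u v]
         `|` [set w : V | exists u, w = voa_Y omega 0 u + voa_Y omega 1 u]).

Definition zhu_algebra (n : nat) : lmodType R[i] := lquot (zhu_O n).

(* Independent of representatives, zhu_O being a two-sided ideal for zhu_star. *)
Definition zhu_mul (n : nat) (a b : zhu_algebra n) : zhu_algebra n :=
  \pi_(lquot (zhu_O n))
    (zhu_star n (repr (a : lquot (zhu_O n))) (repr (b : lquot (zhu_O n)))).

Definition zhu_finite_dim (n : nat) : Prop :=
  finite_dim [pred _ : zhu_algebra n | true].

End CofinitenessAndZhu.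

(* Main.v *)
Require Import Defs.
From HB Require Import structures.
From mathcomp Require Import all_boot all_order all_algebra generic_quotient complex.
From mathcomp Require Import zify ring lra.
From mathcomp Require Import boolp classical_sets cardinality fsbigop reals.

(** Let [lam] be the lowest weight of [W]. If [M] has finite length and is
    generated by a vector [m] of weight [lam], its composition factors have
    lowest weights [lam + j] with [|j| <= N], so the length of [M] is at most the
    sum of the dimensions of these weight spaces. They are bounded independently
    of [M]: since no weight of [M] lies more than [N] below the weight considered,
    [u |-> o(u) m] factors through [A_N(V)], which bounds the weight space of [m]
    itself, and the commutators
      [L(-1), u_j] = - j u_(j-1)
      [L(1), u_j] = (2 wt u - j - 2) u_(j+1) + (L(1) u)_j
    propagate the bound up and down, up to finitely many homogeneous components
    of [V] where the coefficients vanish. A generated pair [(M, m)] of maximal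
    length is then universal, i.e. it represents the exact functor sending a
    module to its generalized weight space of weight [lam]; hence it is
    projective, and it maps onto [W]. Fitting's lemma turns a projective object
    over [W] of minimal length into a projective cover. *)

Set Implicit Arguments.
Unset Strict Implicit.
Unset Printing Implicit Defensive.

Import Order.TTheory GRing.Theory Num.Theory.
Local Open Scope classical_set_scope.
Local Open Scope ring_scope.
Local Open Scope quotient_scope.

(** * Linear algebra *)

(** Finite length modules do not admit infinite limits in general, so an object universal for
    vectors of weight [lam] cannot simply be taken as a limit over all generated pairs; a uniform
    bound on the length replaces the limit by a maximum. What is counted is one vector per
    composition factor: a lift, of the same generalized weight, of a lowest weight vector of the
    factor. Such lifts are independent, and in a module generated in weight [lam] they all lie in
    the [2N+1] weight spaces [lam + j]. The level [N] of the Zhu algebra comes from the spread of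
    the lowest weights: a mode lowering the weight by more than [N] kills [m], and the Jacobi
    identity with [l = -(2N+2)] converts this vanishing into [o(w) m = 0] for the residues [w] that
    generate [O_N(V)]. *)

Lemma ex_min_nat (P : nat -> Prop) :
  (exists n, P n) -> exists2 n, P n & forall m, P m -> (n <= m)%N.
Proof.
move=> [n Pn]; have ex : exists n, `[<P n>] by exists n; apply/asboolP.
case: (ex_minnP ex) => m /asboolP Pm min; exists m => // k Pk.
by apply: min; apply/asboolP.
Qed.

Lemma ex_max_nat (P : nat -> Prop) (B : nat) :
  (exists n, P n) -> (forall n, P n -> (n <= B)%N) ->
  exists2 n, P n & forall m, P m -> (m <= n)%N.
Proof.
move=> [n Pn] PB; have ex : exists n, `[<P n>] by exists n; apply/asboolP.
have ub m : `[<P m>] -> (m <= B)%N by move/asboolP; apply: PB.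
case: (ex_maxnP ex ub) => m /asboolP Pm max; exists m => // k Pk.
by apply: max; apply/asboolP.
Qed.

Section Subspaces.
Variables (K : fieldType) (M : lmodType K).
Implicit Types (S T : submodClosed M) (A : set M) (P : M -> Prop) (s : seq M).

Lemma subspace_of P :
  P 0 -> (forall a u v, P u -> P v -> P (a *: u + v)) ->
  {S : submodClosed M | forall v, v \in S <-> P v}.
Proof.
move=> P0 PD; pose p : {pred M} := fun v => `[<P v>].
have pS : submod_closed p.
  split=> [|a u v /asboolP uP /asboolP vP]; apply/asboolP => //.
  exact: PD.
pose S : submodClosed M := HB.pack p (GRing.isSubmodClosed.Build K M p pS).
by exists S => v; split => [/asboolP|Pv] //; apply/asboolP.
Qed.

(** Leibniz equality, so that subspaces can be rewritten inside [composition_chain]; the closure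
    proofs agree by proof irrelevance. *)
Lemma submod_ext S T : S =i T -> S = T.
Proof.
move: S T => [p [[a] [b]]] [q [[c] [d]]] pq.
have epq : p = q by apply: funext => v; apply: pq.
by subst q; rewrite (Prop_irrelevance a c) (Prop_irrelevance b d).
Qed.

Lemma submodB S u v : u \in S -> v \in S -> u - v \in S.
Proof. by move=> uS vS; rewrite -scaleN1r rpredD ?rpredZ. Qed.

Lemma lspan_gen A a : A a -> a \in lspan A.
Proof. by move=> Aa; apply/asboolP => S; apply. Qed.

Lemma lspan_min A S : (forall a, A a -> a \in S) -> {subset lspan A <= S}.
Proof. by move=> AS v /asboolP; apply. Qed.

Lemma lspan_ind A P :
  P 0 -> (forall a u v, P u -> P v -> P (a *: u + v)) ->
  (forall a, A a -> P a) -> forall v, v \in lspan A -> P v.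
Proof.
move=> P0 PD AP v vA; have [S SP] := subspace_of P0 PD.
by apply/SP; apply: lspan_min vA => a /AP /SP.
Qed.

Lemma lspan_seqP s v :
  v \in lspan [set` s] ->
  exists c : nat -> K, v = \sum_(i < size s) c i *: s`_i.
Proof.
move: v; apply: lspan_ind => [|a u v [c ->] [d ->]|u us].
- by exists (fun=> 0); rewrite big1 // => i _; rewrite scale0r.
- exists (fun i => a * c i + d i); rewrite scaler_sumr -big_split.
  by apply: eq_bigr => i _; rewrite scalerDl scalerA.
- have ui : (index u s < size s)%N by rewrite index_mem.
  exists (fun i => (i == index u s)%:R).
  rewrite (bigD1 (Ordinal ui)) //= eqxx scale1r nth_index // big1 ?addr0 //.
  by move=> i; rewrite -val_eqE /= => /negPf ->; rewrite scale0r.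
Qed.

Lemma lspan_sub_seq s (t : seq M) (v : M) :
  {subset s <= t} -> v \in lspan [set` s] -> v \in lspan [set` t].
Proof. by move=> st; move: v; apply: lspan_min => a /st; apply: lspan_gen. Qed.

(* [x] is independent in the sense of the second hypothesis, so at most
   [size s] many of its terms fit into the span of [s]. *)
Lemma independent_size s n (x : nat -> M) :
  (forall i, (i < n)%N -> x i \in lspan [set` s]) ->
  (forall c : nat -> K, \sum_(i < n) c i *: x i = 0 ->
     forall i, (i < n)%N -> c i = 0) ->
  (n <= size s)%N.
Proof.
move=> xs free; rewrite leqNgt; apply/negP => lt_sn.
have /choice [C CP] : forall i : 'I_n, exists c : nat -> K,
    x i = \sum_(j < size s) c j *: s`_j.
  by move=> i; apply: lspan_seqP; apply: xs.
(* Coordinates of the [x i] in [s]. Having more rows than columns, [A] has a nonzero left kernel,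
   whereas [free] annihilates every row of [kermx A]. *)
pose A := \matrix_(i < n, j < size s) C i j.
have /negP[] : ~~ row_free A.
  by rewrite /row_free neq_ltn (leq_ltn_trans (rank_leq_col A)).
rewrite -kermx_eq0; apply/eqP/row_matrixP => k; rewrite row0.
set v := row k _.
have vA : v *m A = 0 by rewrite /v -row_mul mulmx_ker row0.
pose c i := if insub i is Some j then v 0 (j : 'I_n) else 0.
have cE (i : 'I_n) : c i = v 0 i by rewrite /c valK.
have c0 : forall i, (i < n)%N -> c i = 0.
  apply: free; under eq_bigr do rewrite cE CP scaler_sumr.
  rewrite exchange_big big1 // => j _.
  under eq_bigr do rewrite scalerA.
  rewrite -scaler_suml; suff -> : \sum_(i < n) v 0 i * C i j = 0 by rewrite scale0r.
  transitivity ((v *m A) 0 j); last by rewrite vA mxE.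
  by rewrite [RHS]mxE; apply: eq_bigr => i _; rewrite [A i j]mxE.
by apply/rowP => i; rewrite -cE c0 // mxE.
Qed.

End Subspaces.

Section LinearRelation.
Variables (K : fieldType) (A B : lmodType K).

(** Used for maps known only by their graph: extension from a direct sum, descent to a quotient, the
    universal map and the Fitting projection. *)
Lemma linear_of_rel (r : A -> B -> Prop) :
  (forall x, exists y, r x y) -> (forall y, r 0 y -> y = 0) ->
  (forall a x y x' y', r x y -> r x' y' -> r (a *: x + x') (a *: y + y')) ->
  {f : {linear A -> B} | forall x y, r x y <-> f x = y}.
Proof.
move=> tot uniq rD; pose f x := xget 0 [set y | r x y]%classic.
have fr x : r x (f x).
  by rewrite /f; case: xgetP => [y -> //|] n; have [y /n] := tot x.
have det x y : r x y -> f x = y.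
  move=> xy; symmetry; apply/eqP; rewrite -subr_eq0; apply/eqP; apply: uniq.
  have := rD (-1) _ _ _ _ (fr x) xy.
  by rewrite !scaleN1r addNr addrC.
have flin : linear f by move=> a x y; apply/det/rD.
pose g : {linear A -> B} := HB.pack f (GRing.isLinear.Build K A B *:%R f flin).
by exists g => x y; split => [/det|<-].
Qed.

End LinearRelation.

Section FsSums.
Variables (K : fieldType) (M : lmodType K).

Lemma fsbig_uniq (I : choiceType) (r : seq I) (f : I -> M) :
  uniq r -> (forall i, i \notin r -> f i = 0) ->
  \sum_(i \in [set: I]) f i = \sum_(i <- r) f i.
Proof.
move=> ur f0; rewrite (fsbigE r) //.
  by apply: eq_bigl => i; rewrite in_setT.
by move=> i _; apply: f0.
Qed.

Lemma fsbig_nat (f : nat -> M) (n : nat) :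
  (forall i, (n <= i)%N -> f i = 0) ->
  \sum_(i \in [set: nat]) f i = \sum_(i < n) f i.
Proof.
move=> f0; rewrite (@fsbig_uniq _ (index_iota 0 n)) ?iota_uniq ?big_mkord //.
by move=> i; rewrite mem_index_iota /= -leqNgt => /f0.
Qed.

End FsSums.

(** * Direct sums and generalized eigenspaces *)

Section DirectSums.
Variables (K : fieldType) (V : lmodType K) (I : choiceType).
Variable A : I -> submodClosed V.
Hypothesis dsA : direct_sum (fun i => A i : {pred V}).

Lemma direct_sum_decomp (v : V) : exists (s : seq I) (h : I -> V),
  [/\ uniq s, forall i, h i \in A i, forall i, i \notin s -> h i = 0
    & v = \sum_(i <- s) h i].
Proof.
have [h [[hA hfin ->] _]] := dsA v.
have /finite_seqP[s sE] := hfin.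
have h0 i : i \notin undup s -> h i = 0.
  rewrite mem_undup => nis; apply/eqP; apply: contraNT nis => hi.
  by have : [set` s] i by rewrite -sE.
exists (undup s), h; split; rewrite ?undup_uniq //.
by apply: fsbig_uniq => //; apply: undup_uniq.
Qed.

Lemma direct_sum_uniq (s : seq I) (h : I -> V) : uniq s ->
  (forall i, h i \in A i) -> (forall i, i \notin s -> h i = 0) ->
  \sum_(i <- s) h i = 0 -> forall i, h i = 0.
Proof.
move=> us hA h0 hs i; have [g [_ gU]] := dsA 0.
have hg : g = h.
  apply: gU; split => //; last by rewrite (fsbig_uniq us h0).
  apply: (@sub_finite_set _ _ [set` s]) => [j /= hj|]; last exact: finite_seq.
  by apply: contraNT hj => /h0 ->.
have zg : g = (fun=> 0).
  apply: gU; split => [j||]; [exact: rpred0| |by rewrite fsbig1].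
  by rewrite (_ : mkset _ = set0) //; apply/seteqP; split => j //=; rewrite eqxx.
by rewrite -hg zg.
Qed.

Lemma direct_sum_ind (P : V -> Prop) :
  P 0 -> (forall a u v, P u -> P v -> P (a *: u + v)) ->
  (forall i v, v \in A i -> P v) -> forall v, P v.
Proof.
move=> P0 PD PA v; have [s [h [_ hA _ ->]]] := direct_sum_decomp v.
elim: s => [|i s IH]; rewrite ?big_nil // big_cons -[h i]scale1r.
by apply: PD => //; apply: PA.
Qed.

(** Serves to define [u |-> o(u) m], whose mode index depends on the degree of [u]. Each [g i] is
    linear on all of [V], but only its values on [A i] matter. *)
Lemma direct_sum_linear (M : lmodType K) (g : I -> V -> M) :
  (forall i, linear (g i)) ->
  {f : {linear V -> M} | forall i v, v \in A i -> f v = g i v}.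
Proof.
move=> glin.
have g0 i : g i 0 = 0.
  by have := glin i (-1) 0 0; rewrite scaler0 addr0 scaleN1r addNr.
pose fam v s (h : I -> V) := [/\ uniq s, forall i, h i \in A i,
  forall i, i \notin s -> h i = 0 & v = \sum_(i <- s) h i].
pose r v y := exists s h, fam v s h /\ y = \sum_(i <- s) g i (h i).
have wide (s t : seq I) (W : lmodType K) (k : I -> W) : uniq s -> uniq t ->
    {subset s <= t} -> (forall i, i \notin s -> k i = 0) ->
    \sum_(i <- t) k i = \sum_(i <- s) k i.
  move=> us ut st k0; rewrite -(fsbig_uniq us k0) -(@fsbig_uniq _ _ _ t) //.
  by move=> i it; apply: k0; apply: contra it; apply: st.
have r_tot v : exists y, r v y.
  by have [s [h H]] := direct_sum_decomp v; exists (\sum_(i <- s) g i (h i)), s, h.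
have r0 y : r 0 y -> y = 0.
  move=> [s [h [[us hA h0 vE] ->]]]; rewrite big1 // => i _.
  by rewrite (direct_sum_uniq us hA h0 (esym vE)) g0.
have rD a x y x' y' : r x y -> r x' y' -> r (a *: x + x') (a *: y + y').
  move=> [s [h [[us hA h0 ->] ->]]] [t [k [[ut kA k0 ->] ->]]].
  pose w := undup (s ++ t).
  have uw : uniq w by apply: undup_uniq.
  have sw : {subset s <= w} by move=> i si; rewrite mem_undup mem_cat si.
  have tw : {subset t <= w} by move=> i ti; rewrite mem_undup mem_cat ti orbT.
  exists w, (fun i => a *: h i + k i); split; first split => //.
  - by move=> i; rewrite rpredD ?rpredZ.
  - move=> i; rewrite mem_undup mem_cat negb_or => /andP[/h0 -> /k0 ->].
    by rewrite scaler0 addr0.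
  - by rewrite big_split -scaler_sumr (wide s w _ h) // (wide t w _ k).
  - under [RHS]eq_bigr do rewrite glin.
    rewrite big_split -scaler_sumr.
    rewrite (wide s w _ (fun i => g i (h i))) // => [|i /h0 -> //].
    by rewrite (wide t w _ (fun i => g i (k i))) // => i /k0 ->.
have [f fP] := linear_of_rel r_tot r0 rD; exists f => i v vi.
apply/fP.
pose h j := if j == i then v else 0.
exists [:: i], h; rewrite !big_seq1 {2}/h eqxx.
split=> //; split; rewrite ?big_seq1 /h ?eqxx // => j.
- by case: eqP => [->|_] //; exact: rpred0.
- by rewrite inE => /negPf ->.
Qed.

End DirectSums.

Section GeneralizedEigenspaces.
Variables (K : fieldType) (M : lmodType K) (f : M -> M).
Hypothesis flin : linear f.
Implicit Types (r s : seq K) (v w : M).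

(* The operator \prod_(a <- r) (f - a); that every vector is killed by some such
   operator is equivalent to the grading axiom and, unlike that axiom, passes at
   once to submodules and products. *)
Definition shifts r v : M := foldl (fun w a => f w - a *: w) v r.
Arguments shifts : simpl never.

Let f0 : f 0 = 0.
Proof. by have := flin (-1) 0 0; rewrite scaler0 addr0 scaleN1r addNr. Qed.
Let fZ a w : f (a *: w) = a *: f w.
Proof. by have := flin a w 0; rewrite f0 !addr0. Qed.
Let fN w : f (- w) = - f w.
Proof. by rewrite -scaleN1r fZ scaleN1r. Qed.
Let fD u w : f (u + w) = f u + f w.
Proof. by have := flin 1 u w; rewrite !scale1r. Qed.

Lemma shifts_cons a r v : shifts (a :: r) v = shifts r (f v - a *: v).
Proof. by []. Qed.

Lemma shift1_linear a : linear (fun w => f w - a *: w).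
Proof.
by move=> b u w; rewrite flin scalerDr opprD addrACA scalerBr !scalerA mulrC.
Qed.

Let shift1B b u w : f (u - w) - b *: (u - w) = (f u - b *: u) - (f w - b *: w).
Proof.
by rewrite fD fN scalerBr !opprB -!addrA; congr (_ + _); rewrite addrC -addrA addrCA.
Qed.

Lemma shifts_linear r : linear (shifts r).
Proof. by elim: r => [//|a r IH] b u v; rewrite !shifts_cons shift1_linear IH. Qed.

Lemma shiftsZ r a v : shifts r (a *: v) = a *: shifts r v.
Proof.
elim: r v => [//|b r IH] v; rewrite !shifts_cons -IH; congr shifts.
by rewrite fZ scalerBr !scalerA mulrC.
Qed.

Lemma shifts0 r : shifts r 0 = 0.
Proof. by rewrite -(scale0r (0 : M)) shiftsZ !scale0r. Qed.

Lemma shiftsD r u v : shifts r (u + v) = shifts r u + shifts r v.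
Proof. by have := shifts_linear r 1 u v; rewrite !scale1r. Qed.

Lemma shiftsN r v : shifts r (- v) = - shifts r v.
Proof. by rewrite -!scaleN1r shiftsZ. Qed.

Lemma shifts_cat r s v : shifts (r ++ s) v = shifts s (shifts r v).
Proof. exact: foldl_cat. Qed.

Lemma shifts_shift1 r a v :
  shifts r (f v - a *: v) = f (shifts r v) - a *: shifts r v.
Proof.
elim: r v => [//|b r IH] v; rewrite !shifts_cons -IH; congr shifts.
rewrite !fD !fN !fZ !scalerBr !scalerA mulrC !opprB.
by rewrite -!addrA; congr (_ + _); rewrite addrCA addrA addrC addrA; congr (_ + _).
Qed.

Lemma shifts_comm r s v : shifts r (shifts s v) = shifts s (shifts r v).
Proof.
elim: s v => [//|a s IH] v; rewrite !shifts_cons.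
by rewrite IH shifts_shift1.
Qed.

Lemma shifts_catl r s v : shifts r v = 0 -> shifts (r ++ s) v = 0.
Proof. by rewrite shifts_cat => ->; rewrite shifts0. Qed.

Lemma shifts_catr r s v : shifts s v = 0 -> shifts (r ++ s) v = 0.
Proof. by rewrite shifts_cat shifts_comm => ->; rewrite shifts0. Qed.

Lemma gen_eigenP a v :
  v \in gen_eigenspace f a <-> exists k, shifts (nseq k a) v = 0.
Proof.
have E k w : iter k (fun x => f x - a *: x) w = shifts (nseq k a) w.
  by elim: k w => [//|k IH] w; rewrite iterSr IH.
split=> [/asboolP[k]|[k]]; rewrite ?E => kv; first by exists k.
by apply/asboolP; exists k; rewrite E.
Qed.

Lemma gen_eigen_submod a : submod_closed (gen_eigenspace f a).
Proof.
split=> [|b u v /gen_eigenP[k uk] /gen_eigenP[l vl]]; apply/gen_eigenP.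
  by exists 0%N.
exists (k + l)%N; rewrite nseqD shifts_linear (shifts_catl _ uk).
by rewrite (shifts_catr _ vl) scaler0 addr0.
Qed.

Lemma shifts_eigen r a v : f v = a *: v ->
  shifts r v = (\prod_(b <- r) (a - b)) *: v.
Proof.
move=> fv; elim: r => [|b r IH]; first by rewrite big_nil scale1r.
rewrite big_cons shifts_cons fv -scalerBl shiftsZ IH.
by rewrite scalerA.
Qed.

(** Induction on the nilpotency exponent reduces to a true eigenvector, on which [shifts r] is
    multiplication by a product of nonzero scalars [a - b]. *)
Lemma gen_eigen_coprime r a v :
  v \in gen_eigenspace f a -> shifts r v = 0 -> a \notin r -> v = 0.
Proof.
move=> /gen_eigenP[k]; elim: k v => [//|k IH] v vk vr ar.
have fv : f v = a *: v.
  apply/eqP; rewrite -subr_eq0; apply/eqP; apply: IH => //.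
  by rewrite shifts_shift1 vr f0 scaler0 subr0.
move: vr; rewrite (shifts_eigen _ fv) => /eqP; rewrite scaler_eq0.
case/orP => [|/eqP //]; rewrite prodf_seq_eq0 => /hasP[b br /=].
by rewrite subr_eq0 => /eqP eab; rewrite eab br in ar.
Qed.

Variable S : submodClosed M.
Hypothesis fS : {in S, forall w, f w \in S}.

(** [X - a] is invertible modulo a polynomial without the root [a]; the inverse is built root by
    root, hence stays in the [f]-stable [S]. *)
Lemma shift1_onto r a v : v \in S -> shifts r v = 0 -> a \notin r ->
  exists z, [/\ z \in S, shifts r z = 0 & f z - a *: z = v].
Proof.
elim: r v => [|b r IH] v vS vr.
  by exists 0; rewrite rpred0; split=> //; rewrite [v]vr f0 scaler0 subr0.
rewrite inE negb_or eq_sym => /andP[ba ar].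
have [z [zS zr zE]] := IH (f v - b *: v) (submodB (fS vS) (rpredZ b vS)) vr ar.
have ba0 : b - a != 0 by rewrite subr_eq0.
(* From [(f - a) z = (f - b) v] follows [(f - a) (v - z) = (b - a) v]. *)
exists ((b - a)^-1 *: (v - z)); split.
- by rewrite rpredZ ?submodB.
- rewrite shiftsZ shifts_cons shift1B shiftsD shiftsN shifts_shift1 zr f0.
  by rewrite -shifts_cons vr scaler0 !subrr scaler0.
- rewrite -[RHS]scale1r -(mulVf ba0) -scalerA.
  rewrite fZ [a *: (_ *: _)]scalerA [a * _]mulrC -[X in _ - X]scalerA -scalerBr.
  congr (_ *: _).
  by rewrite shift1B zE opprB addrCA [f v - _ - _]addrAC subrr add0r scalerBl.
Qed.

(** By induction [(f - b) v] splits as [w1 + w2]. If [b = a], lift [w2] through [f - a]; otherwise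
    lift [w1] through [f - b]. Subtracting the lift from [v] gives the other summand. Staying in [S]
    matters for maps defined only on [S]. *)
Lemma gen_eigen_split s a v : v \in S -> shifts s v = 0 ->
  exists v1 v2, [/\ v = v1 + v2, v1 \in S, v2 \in S, v1 \in gen_eigenspace f a
    & shifts [seq b <- s | b != a] v2 = 0].
Proof.
elim: s v => [|b s IH] v vS vs.
  by exists 0, 0; rewrite addr0 !rpred0; split=> //; apply: (gen_eigen_submod a).1.
have [w1 [w2 [wE w1S w2S w1a w2s]]] :=
  IH (f v - b *: v) (submodB (fS vS) (rpredZ b vS)) vs.
rewrite /=; have [eba|nba] /= := eqVneq b a.
  subst b; have [|z [zS zs zE]] := shift1_onto (a := a) w2S w2s.
    by rewrite mem_filter eqxx.
  exists (v - z), z; rewrite subrK submodB //; split=> //.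
  have [k wk] := (gen_eigenP a w1).1 w1a.
  apply/gen_eigenP; exists k.+1; rewrite shifts_cons.
  rewrite shift1B zE wE.
  by rewrite addrK.
have [k wk] := (gen_eigenP a w1).1 w1a.
have [|z [zS zk zE]] := shift1_onto (a := b) w1S wk.
  by rewrite mem_nseq negb_and nba orbT.
exists z, (v - z); rewrite addrC subrK submodB //; split=> //.
  by apply/gen_eigenP; exists k.
rewrite shifts_cons shift1B zE wE.
by rewrite addrC addKr.
Qed.

End GeneralizedEigenspaces.

Section LocallyFinite.
Variables (K : fieldType) (M : lmodType K) (f : M -> M).
Hypothesis flin : linear f.

Lemma gen_eigen_direct_sum :
  direct_sum (gen_eigenspace f) <-> forall v, exists r, shifts f r v = 0.
Proof.
split=> [ds v|lf].
  have [g [[gA gfin ->] _]] := ds v.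
  have /finite_seqP[s sE] := gfin.
  rewrite (@fsbig_uniq _ _ _ (undup s)) ?undup_uniq //; last first.
    move=> i; rewrite mem_undup => nis; apply/eqP; apply: contraNT nis => gi.
    by have : [set` s] i by rewrite -sE.
  elim: (undup s) => [|a r [q rq]]; first by exists [::]; rewrite big_nil.
  have [k gk] := (gen_eigenP f a _).1 (gA a).
  exists (nseq k a ++ q); rewrite big_cons (shiftsD flin).
  by rewrite (shifts_catl flin _ gk) (shifts_catr flin _ rq) addr0.
move=> v; have ex : exists s (g : K -> M), [/\ uniq s,
    forall i, g i \in gen_eigenspace f i, forall i, i \notin s -> g i = 0
    & v = \sum_(i <- s) g i].
  have [r] := lf v; have [n] := ubnP (size r); elim: n r v => // n IH [|a r] v.
    move=> _ v0; exists [::], (fun=> 0); rewrite big_nil; split=> // i.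
    exact: (gen_eigen_submod flin i).1.
  rewrite ltnS => rn vr.
  have [T TP] : {T : submodClosed M | forall v, v \in T <-> True}.
    exact: subspace_of.
  have fT : {in T, forall w, f w \in T} by move=> w _; apply/TP.
  have [v1 [v2 [-> _ _ v1a]]] := gen_eigen_split flin fT a (proj2 (TP v) I) vr.
  rewrite /= eqxx /= => v2r.
  have [|s [g [us gA g0 ->]]] := IH [seq b <- r | b != a] v2 _ v2r.
    by apply: leq_trans rn; rewrite ltnS size_filter count_size.
  (* The decomposition of [v2] is not known to avoid the index [a], so [v1] is added to its
     component there. *)
  pose g' i := if i == a then v1 + g a else g i.
  have g'0 i : i \notin undup (a :: s) -> g' i = 0.
    by rewrite mem_undup inE negb_or /g' => /andP[/negPf -> /g0].
  exists (undup (a :: s)), g'; split=> //; first exact: undup_uniq.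
    move=> i; rewrite /g'; case: eqP => [->|//].
    by have := (gen_eigen_submod flin a).2 1 v1 (g a) v1a (gA a); rewrite scale1r.
  have e1 : \sum_(i <- undup (a :: s)) (if i == a then v1 else 0) = v1.
    rewrite (bigD1_seq a) ?undup_uniq ?mem_undup ?mem_head //= eqxx big1 ?addr0 //.
    by move=> i /negPf ->.
  have e2 : \sum_(i <- undup (a :: s)) g i = \sum_(i <- s) g i.
    rewrite -(fsbig_uniq us g0) -(@fsbig_uniq _ _ _ (undup (a :: s))) //.
      exact: undup_uniq.
    by move=> i; rewrite mem_undup inE negb_or => /andP[_ /g0].
  rewrite -{1}e1 -e2 -big_split; apply: eq_bigr => i _ /=; rewrite /g'.
  by case: eqP => [->|_]; rewrite ?add0r.
have [s [g [us gA g0 vE]]] := ex; exists g; split.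
  split=> //; last by rewrite (fsbig_uniq us g0).
  apply: (@sub_finite_set _ _ [set` s]) => [j /= hj|]; last exact: finite_seq.
  by apply: contraNT hj => /g0 ->.
move=> h [hA hfin vh]; apply: funext => a.
have /finite_seqP[t tE] := hfin; pose w := undup (s ++ t).
have g0w i : i \notin w -> g i = 0.
  by rewrite mem_undup mem_cat negb_or => /andP[/g0].
have h0w i : i \notin w -> h i = 0.
  rewrite mem_undup mem_cat negb_or => /andP[_ nit]; apply/eqP.
  by apply: contraNT nit => hi; have : [set` t] i by rewrite -tE.
have uw : uniq w by apply: undup_uniq.
pose d i := g i - h i.
have dA i : d i \in gen_eigenspace f i.
  have := (gen_eigen_submod flin i).2 (-1) (h i) (g i) (hA i) (gA i).
  by rewrite scaleN1r addrC.
have d0 : \sum_(i <- w) d i = 0.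
  rewrite sumrB -(fsbig_uniq uw g0w) -(fsbig_uniq uw h0w) -vh.
  by rewrite (fsbig_uniq us g0) -vE subrr.
suff : d a = 0 by move/eqP; rewrite subr_eq0 => /eqP.
have [aw|/[dup] /g0w + /h0w +] := boolP (a \in w); last first.
  by rewrite /d => -> ->; rewrite subrr.
(* By [d0], [d a] is minus the sum of the other components, which some [q] avoiding [a] kills;
   coprimality then gives [d a = 0]. *)
have [q qa q0] : exists2 q, a \notin q & shifts f q (\sum_(i <- w | i != a) d i) = 0.
  elim: w {uw g0w h0w d0 aw} => [|b w [q qa q0]].
    by exists [::]; rewrite ?big_nil.
  rewrite big_cons; have [_|nba] := eqVneq b a; first by exists q.
  have [k dk] := (gen_eigenP f b _).1 (dA b).
  exists (nseq k b ++ q).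
    by rewrite mem_cat negb_or qa mem_nseq negb_and eq_sym nba orbT.
  rewrite (shiftsD flin).
  by rewrite (shifts_catl flin _ dk) (shifts_catr flin _ q0) addr0.
apply: (gen_eigen_coprime flin (dA a) _ qa).
move: d0; rewrite (bigD1_seq a) //= => /eqP; rewrite addr_eq0 => /eqP ->.
by rewrite (shiftsN flin) q0 oppr0.
Qed.

End LocallyFinite.

(** * Jacobi identity with finite sums; transfer along module maps *)

Section FiniteJacobi.
Variables (R : realType) (V W : lmodType R[i]).
Variables (YV : V -> int -> V -> V) (YW : V -> int -> W -> W).

(** Sums cut off at [k] commute with every module map without any discussion of supports. *)
Definition jacobi_lhs (u v : V) (w : W) (l m n : int) (k : nat) : W :=
  \sum_(i < k) ((-1) ^+ i * binomial_coef (l%:~R : R[i]) i) *: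
      YW u (l + m - i%:Z) (YW v (n + i%:Z) w)
  - \sum_(i < k) ((-1) ^ l * (-1) ^+ i * binomial_coef (l%:~R : R[i]) i) *:
      YW v (l + n - i%:Z) (YW u (m + i%:Z) w).

Definition jacobi_rhs (u v : V) (w : W) (l m n : int) (k : nat) : W :=
  \sum_(i < k) binomial_coef (m%:~R : R[i]) i *:
      YW (YV u (l + i%:Z) v) (m + n - i%:Z) w.

Hypotheses (bV : bilinear_modes YV) (bW : bilinear_modes YW).
Hypotheses (tV : lower_truncation YV) (tW : lower_truncation YW).

Lemma linear_at0 (A B : lmodType R[i]) (f : A -> B) : linear f -> f 0 = 0.
Proof. by move=> fl; have := fl (-1) 0 0; rewrite scaler0 addr0 scaleN1r addNr. Qed.

Lemma truncation_nat (A B : lmodType R[i]) (Y : A -> int -> B -> B) u w (n : int) :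
  lower_truncation Y -> exists k : nat, forall i, (k <= i)%N -> Y u (n + i%:Z) w = 0.
Proof.
move=> /(_ u w)[N NP]; exists `|N - n|%N => i ki; apply: NP.
rewrite -lerBlDl (le_trans (ler_norm _)) // -abszE.
Qed.

Lemma jacobi_finite (u v : V) (w : W) (l m n : int) :
  exists k0 : nat, forall k, (k0 <= k)%N ->
  [/\ \sum_(i \in [set: nat]) ((-1) ^+ i * binomial_coef (l%:~R : R[i]) i) *:
          YW u (l + m - i%:Z) (YW v (n + i%:Z) w)
      - \sum_(i \in [set: nat])
        ((-1) ^ l * (-1) ^+ i * binomial_coef (l%:~R : R[i]) i) *:
          YW v (l + n - i%:Z) (YW u (m + i%:Z) w) = jacobi_lhs u v w l m n k
    & \sum_(i \in [set: nat])
      binomial_coef (m%:~R : R[i]) i *: YW (YV u (l + i%:Z) v) (m + n - i%:Z) w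
      = jacobi_rhs u v w l m n k].
Proof.
have [k1 k1P] := truncation_nat v w n tW.
have [k2 k2P] := truncation_nat u w m tW.
have [k3 k3P] := truncation_nat u v l tV.
exists (k1 + k2 + k3)%N => k kk.
have W0 x j : YW x j 0 = 0 by apply: linear_at0; apply: bW.2.
have V0 j y : YW 0 j y = 0 by apply: (@linear_at0 _ _ (YW^~ j ^~ y)); apply: bW.1.
split; first congr (_ - _); apply: fsbig_nat => i ki.
- by rewrite k1P ?W0 ?scaler0 //; lia.
- by rewrite k2P ?W0 ?scaler0 //; lia.
- by rewrite k3P ?V0 ?scaler0 //; lia.
Qed.

(** Asking for all large [k] lets the cut-offs coming from several modules be merged. *)
Lemma jacobi_identityP : jacobi_identity YV YW <->
  forall u v w l m n, exists k0 : nat, forall k, (k0 <= k)%N ->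
    jacobi_lhs u v w l m n k = jacobi_rhs u v w l m n k.
Proof.
split=> [jac u v w l m n|jac u v w l m n].
  have [k0 k0P] := jacobi_finite u v w l m n; exists k0 => k /k0P[<- <-].
  exact: jac.
have [k0 k0P] := jacobi_finite u v w l m n; have [k1 k1P] := jac u v w l m n.
have [-> ->] := k0P _ (leq_addr k1 k0).
exact: k1P (leq_addl _ _).
Qed.

End FiniteJacobi.

Section Transfer.
Variables (R : realType) (V : voa R).
Implicit Types (A B C : action V).

Lemma L0_linear A : is_gen_module A -> linear (@L0 R V A).
Proof. by move=> gA; apply: (gm_bilinear gA).2. Qed.

Lemma module_map_L0 A B (f : {linear A -> B}) w : module_map f -> f (L0 w) = L0 (f w).
Proof. by move=> mf; apply: mf. Qed.

Lemma module_map_shifts A B (f : {linear A -> B}) r w : module_map f ->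
  f (shifts (@L0 R V A) r w) = shifts (@L0 R V B) r (f w).
Proof.
move=> mf; elim: r w => [//|a r IH] w.
by rewrite !shifts_cons IH linearB linearZ /= module_map_L0.
Qed.

Lemma module_map_jacobi A B (f : {linear A -> B}) u v w l m n k : module_map f ->
  f (jacobi_lhs (@act_Y R V A) u v w l m n k) =
    jacobi_lhs (@act_Y R V B) u v (f w) l m n k /\
  f (jacobi_rhs (@voa_Y R V) (@act_Y R V A) u v w l m n k) =
    jacobi_rhs (@voa_Y R V) (@act_Y R V B) u v (f w) l m n k.
Proof.
move=> mf; rewrite /jacobi_lhs /jacobi_rhs linearB !(linear_sum f).

by split; first congr (_ - _); apply: eq_bigr => i _; rewrite linearZ /= !mf.
Qed.

Lemma gen_module_jacobi A : is_gen_module A ->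
  forall u v (w : A) l m n, exists k0 : nat, forall k, (k0 <= k)%N ->
    jacobi_lhs (@act_Y R V A) u v w l m n k =
    jacobi_rhs (@voa_Y R V) (@act_Y R V A) u v w l m n k.
Proof.
move=> gA; apply/jacobi_identityP; last exact: gm_jacobi.
- exact: gm_bilinear.
- exact: voa_truncation.
- exact: gm_truncation.
Qed.

(** The axioms are identities, vanishing conditions and local finiteness of [L(0)], all of which can
    be tested under a jointly injective pair of module maps. Submodules use [f = g], products the
    two projections. *)
Lemma gen_module_of_inj A B C (f : {linear A -> B}) (g : {linear A -> C}) :
  module_map f -> module_map g -> (forall x, f x = 0 -> g x = 0 -> x = 0) ->
  is_gen_module B -> is_gen_module C -> is_gen_module A.
Proof.
move=> mf mg inj gB gC.
have eq2 x y : f x = f y -> g x = g y -> x = y.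
  move=> ef eg; apply/eqP; rewrite -subr_eq0; apply/eqP.
  by apply: inj; rewrite linearB ?ef ?eg subrr.
have bA : bilinear_modes (@act_Y R V A).
  split=> [n w a u v|u n a v w]; apply: eq2; rewrite !(mf, mg, linearP) /= ?mf ?mg.
  - exact: (gm_bilinear gB).1.
  - exact: (gm_bilinear gC).1.
  - exact: (gm_bilinear gB).2.
  - exact: (gm_bilinear gC).2.
have tA : lower_truncation (@act_Y R V A).
  move=> u w; have [N NP] := gm_truncation gB u (f w).
  have [N' NP'] := gm_truncation gC u (g w).
  exists (Num.max N N') => n; rewrite ge_max => /andP[nN nN'].
  by apply: inj; rewrite ?mf ?mg ?NP ?NP'.
have lA : linear (@L0 R V A) by apply: bA.2.
split=> //.
- apply/(gen_eigen_direct_sum lA) => w.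
  have [r rP] := (gen_eigen_direct_sum (L0_linear gB)).1 (gm_grading gB) (f w).
  have [s sP] := (gen_eigen_direct_sum (L0_linear gC)).1 (gm_grading gC) (g w).
  exists (r ++ s); apply: inj; rewrite module_map_shifts //.
    by rewrite (shifts_catl (L0_linear gB) _ rP).
  by rewrite (shifts_catr (L0_linear gC) _ sP).
- move=> n w; apply: eq2; rewrite ?mf ?mg ?(gm_vacuum gB) ?(gm_vacuum gC);
  by case: ifP; rewrite ?linear0.
- apply/jacobi_identityP => //; first exact: voa_truncation.
  move=> u v w l m n; have [k1 k1P] := gen_module_jacobi gB u v (f w) l m n.
  have [k2 k2P] := gen_module_jacobi gC u v (g w) l m n.
  exists (k1 + k2)%N => k kk; apply: eq2.
    have [-> ->] := module_map_jacobi u v w l m n k mf.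
    by apply: k1P; apply: leq_trans kk; apply: leq_addr.
  have [-> ->] := module_map_jacobi u v w l m n k mg.
  by apply: k2P; apply: leq_trans kk; apply: leq_addl.
- move=> m n w; apply: eq2; rewrite linearB linearD !linearZ /= !(mf, mg).
    by rewrite (gm_virasoro gB); case: ifP; rewrite ?linearZ ?linear0.
  by rewrite (gm_virasoro gC); case: ifP; rewrite ?linearZ ?linear0.
- move=> u n w; apply: eq2; rewrite linearN linearZ /= !(mf, mg).
    exact: gm_derivative.
  exact: gm_derivative.
Qed.

Lemma sub_action_gen A (S : submodClosed A) (sS : stable S) :
  is_gen_module A -> is_gen_module (sub_action sS).
Proof.
move=> gA; pose f : {linear sub_action sS -> A} := (val : subspace S -> A).
by apply: (@gen_module_of_inj _ A A f f) => // x fx _; apply: val_inj.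
Qed.

Definition gen_submodule_of A (gA : is_gen_module A) (S : submodClosed A)
    (sS : stable S) : gen_submodule A :=
  GenSubmodule (sub_action_gen sS gA).

Definition prod_action A B : action V :=
  @Action R V (A * B)%type (fun u n x => (act_Y u n x.1, act_Y u n x.2)).

Lemma prod_action_gen A B :
  is_gen_module A -> is_gen_module B -> is_gen_module (prod_action A B).
Proof.
move=> gA gB.
pose f : {linear prod_action A B -> A} := (fst : A * B -> A).
pose g : {linear prod_action A B -> B} := (snd : A * B -> B).
apply: (@gen_module_of_inj _ A B f g) => //.
by move=> [x y] /= -> ->.
Qed.

End Transfer.

(** * Composition chains *)

Section Submodules.
Variables (R : realType) (V : voa R).
Implicit Types (A B X : action V).

Definition full_sub (M : lmodType R[i]) : submodClosed M :=
  sval (@subspace_of _ M (fun=> True) I (fun _ _ _ _ _ => I)).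

Lemma in_full (M : lmodType R[i]) (x : M) : x \in full_sub M.
Proof. by rewrite /full_sub; case: subspace_of => S SP /=; apply/SP. Qed.

Definition zero_sub (M : lmodType R[i]) : submodClosed M := lspan set0.

Lemma in_zero (M : lmodType R[i]) (x : M) : x \in zero_sub M <-> x = 0.
Proof.
split=> [|->]; last exact: rpred0.
by move: x; apply: lspan_ind => // a u v -> ->; rewrite scaler0 addr0.
Qed.

Lemma preim_subspace (M N : lmodType R[i]) (f : {linear M -> N}) (S : submodClosed N) :
  {T : submodClosed M | forall x, x \in T <-> f x \in S}.
Proof.
apply: subspace_of => [|a u v uS vS]; first by rewrite linear0 rpred0.
by rewrite linearP rpredD ?rpredZ.
Qed.

Definition preim_sub (M N : lmodType R[i]) (f : {linear M -> N}) (S : submodClosed N) :=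
  sval (preim_subspace f S).

Lemma in_preim (M N : lmodType R[i]) (f : {linear M -> N}) (S : submodClosed N) x :
  x \in preim_sub f S <-> f x \in S.
Proof. exact: (svalP (preim_subspace f S)). Qed.

Lemma im_subspace (M N : lmodType R[i]) (f : {linear M -> N}) (S : submodClosed M) :
  {T : submodClosed N | forall y, y \in T <-> exists2 x, x \in S & f x = y}.
Proof.
apply: subspace_of => [|a _ _ [u uS <-] [v vS <-]].
  by exists 0; rewrite ?rpred0 ?linear0.
by exists (a *: u + v); rewrite ?linearP ?rpredD ?rpredZ.
Qed.

Definition im_sub (M N : lmodType R[i]) (f : {linear M -> N}) (S : submodClosed M) :=
  sval (im_subspace f S).

Lemma in_im (M N : lmodType R[i]) (f : {linear M -> N}) (S : submodClosed M) y :
  y \in im_sub f S <-> exists2 x, x \in S & f x = y.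
Proof. exact: (svalP (im_subspace f S)). Qed.

Lemma cap_subspace (M : lmodType R[i]) (S T : submodClosed M) :
  {U : submodClosed M | forall x, x \in U <-> x \in S /\ x \in T}.
Proof.
apply: subspace_of => [|a u v [uS uT] [vS vT]]; first by split; apply: rpred0.
by split; rewrite rpredD ?rpredZ.
Qed.

Definition cap_sub (M : lmodType R[i]) (S T : submodClosed M) :=
  sval (cap_subspace S T).

Lemma in_cap (M : lmodType R[i]) (S T : submodClosed M) x :
  x \in cap_sub S T <-> x \in S /\ x \in T.
Proof. exact: (svalP (cap_subspace S T)). Qed.

Lemma full_stable A : stable (full_sub A).
Proof. by move=> u n w _; apply: in_full. Qed.

Lemma act_Y0 A u n : is_gen_module A -> @act_Y R V A u n 0 = 0.
Proof. by move=> gA; apply: linear_at0; apply: (gm_bilinear gA).2. Qed.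

Lemma act_YP A u n a (x y : A) : is_gen_module A ->
  act_Y u n (a *: x + y) = a *: act_Y u n x + act_Y u n y.
Proof. by move=> gA; apply: (gm_bilinear gA).2. Qed.

Lemma act_YB A u n (x y : A) : is_gen_module A ->
  act_Y u n (x - y) = act_Y u n x - act_Y u n y.
Proof. by move=> gA; rewrite addrC -scaleN1r act_YP // scaleN1r addrC. Qed.

Lemma zero_stable A : is_gen_module A -> stable (zero_sub A).
Proof. by move=> gA u n w /in_zero ->; rewrite act_Y0 // rpred0. Qed.

Lemma preim_stable A B (f : {linear A -> B}) S :
  module_map f -> stable S -> stable (preim_sub f S).
Proof. by move=> mf sS u n w /in_preim wS; apply/in_preim; rewrite mf; apply: sS. Qed.

Lemma im_stable A B (f : {linear A -> B}) S :
  module_map f -> stable S -> stable (im_sub f S).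
Proof.
move=> mf sS u n _ /in_im[x xS <-]; apply/in_im; exists (act_Y u n x) => //.
exact: sS.
Qed.

Lemma cap_stable A (S T : submodClosed A) :
  stable S -> stable T -> stable (cap_sub S T).
Proof.
by move=> sS sT u n w /in_cap[wS wT]; apply/in_cap; split; [apply: sS|apply: sT].
Qed.

Lemma irreducible_stable X (S : submodClosed X) : irreducible_module X -> stable S ->
  S = zero_sub X \/ S = full_sub X.
Proof.
move=> [[gX _ _] [_ irr]] sS; case: (irr (gen_submodule_of gX sS)) => H.
  left; apply: submod_ext => x; apply/idP/idP => [/H -> |/in_zero ->];
  exact: rpred0.
by right; apply: submod_ext => x; rewrite in_full H.
Qed.

(** Lets a composition factor be replaced by any isomorphic model, as [simple_stepP] requires. *)
Lemma irreducible_transport A B (f : {linear A -> B}) : module_map f ->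
  (forall x, f x = 0 -> x = 0) -> (forall y, exists x, f x = y) ->
  irreducible_module B -> irreducible_module A.
Proof.
move=> mf inj sur irB; have [[gB [[b bP] fdB] ssB] [[y y0] _]] := irB.
have gA : is_gen_module A by apply: (@gen_module_of_inj _ _ A B B f f) => // x /inj.
have injf x x' : f x = f x' -> x = x'.
  by move=> e; apply/eqP; rewrite -subr_eq0; apply/eqP/inj; rewrite linearB e subrr.
have lA := L0_linear gA; have lB := L0_linear gB.
have wtf n x : x \in @weight_space R V A n <-> f x \in @weight_space R V B n.
  split=> /gen_eigenP[k xk]; apply/gen_eigenP; exists k.
    by rewrite -module_map_shifts // xk linear0.
  by apply: inj; rewrite module_map_shifts.
split; first split=> //; first split.
- by exists b => n w nb /wtf /(bP _ _ nb) /inj.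
- move=> n; have [s sP] := fdB n.
  have [t tE] : exists t : seq A, map f t = s.
    elim: {sP} s => [|x s [t <-]]; first by exists [::].
    by have [z <-] := sur x; exists (z :: t).
  exists t => x; apply/idP/idP => [/wtf|xt].
    rewrite sP => fx; have : exists2 z, z \in lspan [set` t] & f z = f x.
      move: (f x) fx; apply: lspan_ind => [|a _ _ [u ut <-] [v vt <-]|w /=].
      - by exists 0; rewrite ?rpred0 ?linear0.
      - by exists (a *: u + v); rewrite ?linearP ?rpredD ?rpredZ.
      - by rewrite -tE => /mapP[z zt ->]; exists z => //; apply: lspan_gen.
    by move=> [z zt /injf <-].
  apply/wtf; rewrite sP; move: x xt; apply: lspan_ind => [|a u v ut vt|w wt].
  - by rewrite linear0 rpred0.
  - by rewrite linearP rpredD ?rpredZ.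
  - by apply: lspan_gen; rewrite /= -tE map_f.
- move=> n w /wtf /ssB e; apply: injf.
  by rewrite module_map_L0 // e linearZ.
- split; first by have [x xy] := sur y; exists x; apply: contra_neq y0 => x0;
    rewrite -xy x0 linear0.
  move=> S; have sS := @gs_stable _ _ _ S.
  have [E|E] := irreducible_stable irB (im_stable mf sS); [left|right] => w.
    move=> wS; apply: inj; apply/in_zero; rewrite -E; apply/in_im.
    by exists w.
  have : f w \in full_sub B by apply: in_full.
  by rewrite -E => /in_im[x xS /injf <-].
Qed.

(** A homomorphism on [S] carried by a total function on [A] whose values outside [S] are arbitrary;
    no type for [S] has to be formed. *)
Definition partial_map A X (S : submodClosed A) (f : A -> X) : Prop :=
  (forall a x y, x \in S -> y \in S -> f (a *: x + y) = a *: f x + f y) /\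
  (forall u n x, x \in S -> f (act_Y u n x) = act_Y u n (f x)).

(** [S / T] is irreducible, expressed without a quotient: pulling back along a map or intersecting
    with a submodule then only composes or restricts [f]. *)
Definition simple_step A (S T : submodClosed A) : Prop :=
  stable S /\ exists2 X : action V, irreducible_module X &
  exists f : A -> X, [/\ partial_map S f, forall y, exists2 x, x \in S & f x = y
    & forall x, x \in T <-> x \in S /\ f x = 0].

Fixpoint composition_chain A (l : nat) (S T : submodClosed A) : Prop :=
  if l is k.+1 then
    exists2 S' : submodClosed A, simple_step S S' & composition_chain k S' T
  else S = T.

Lemma lquot_pi_lin (M : lmodType R[i]) (S : submodClosed M) a (x y : M) :
  \pi_(lquot S) (a *: x + y) = a *: (\pi_(lquot S) x : lquot S) + \pi_(lquot S) y.
Proof. by rewrite lquot_pi_add -lquot_scale_pi. Qed.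

Lemma lquot_pi_eq0 (M : lmodType R[i]) (S : submodClosed M) (x : M) :
  \pi_(lquot S) x = 0 :> lquot S <-> x \in S.
Proof.
have <- : \pi_(lquot S) 0 = 0 :> lquot S.
  have := lquot_pi_lin S (-1) 0 0; rewrite scaler0 addr0.
  by rewrite scaleN1r addNr.
by rewrite -{2}[x]subr0; split=> /lquot_eqP.
Qed.

Lemma simple_stepP A (S T : gen_submodule A) : is_gen_module A -> {subset T <= S} ->
  irreducible_module (subquotient S T) <-> simple_step S T.
Proof.
move=> gA TS; pose rT := relative (S := gs_pred S) (gs_pred T).
have rTE x : x \in rT = (val x \in gs_pred T) by [].
have actE u n (x y : subspace S) :
    val (act_Y (a := sub_action (@gs_stable _ _ _ S)) u n x - y) =
    act_Y u n (val x) - val y by rewrite linearB.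
(* Modes of the quotient are defined through chosen representatives; stability of [T] makes the
   choice irrelevant. *)
have actB u n (x : subspace S) : \pi_(lquot rT) (act_Y
    (a := sub_action (@gs_stable _ _ _ S)) u n (repr (\pi_(lquot rT) x))) =
  \pi_(lquot rT) (act_Y (a := sub_action (@gs_stable _ _ _ S)) u n x).
  apply/lquot_eqP; rewrite rTE actE -act_YB // -linearB; apply: gs_stable.
  by rewrite -rTE; apply/lquot_eqP; rewrite reprK.
split=> [irr|[sS [X irX [f [[fl fm] fsur fker]]]]].
  split; first exact: gs_stable.
  exists (subquotient S T) => //.
  (* Vectors outside [S] are sent to the default 0, which [partial_map] permits. *)
  pose i x : subspace S := insubd 0 x.
  have iE x : x \in gs_pred S -> val (i x) = x by move=> xS; rewrite val_insubd xS.
  exists (fun x => \pi_(lquot rT) (i x)); split; first split.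
  - move=> a x y xS yS; rewrite -lquot_pi_lin; congr (\pi_(lquot rT) _).
    by apply: val_inj; rewrite linearP /= !iE // rpredD ?rpredZ.
  - move=> u n x xS; rewrite /= actB; congr (\pi_(lquot rT) _).
    by apply: val_inj; rewrite /= !iE // gs_stable.
  - move=> y; exists (val (repr y)); first exact: valP.
    by rewrite /i valKd reprK.
  - move=> x; split=> [xT|[xS /lquot_pi_eq0]].
      by split; [exact: TS|apply/lquot_pi_eq0; rewrite rTE iE ?TS].
    by rewrite rTE iE.
(* The graph of the isomorphism from the subquotient to [X] induced by [f]. *)
pose r (q : lquot rT) y := exists2 x : subspace S, \pi_(lquot rT) x = q & f (val x) = y.
have f0 : f 0 = 0 by have [] := (fker 0).1 (rpred0 _).
have fB x y : x \in gs_pred S -> y \in gs_pred S -> f (x - y) = f x - f y.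
  by move=> xS yS; rewrite addrC -scaleN1r fl // scaleN1r addrC.
have rtot q : exists y, r q y by exists (f (val (repr q))), (repr q); rewrite ?reprK.
have r0 y : r 0 y -> y = 0.
  by move=> [x /lquot_pi_eq0 xT <-]; have [] := (fker (val x)).1 xT.
have rD a q y q' y' : r q y -> r q' y' -> r (a *: q + q') (a *: y + y').
  move=> [x <- <-] [x' <- <-]; exists (a *: x + x'); first exact: lquot_pi_lin.
  by rewrite linearP /= fl //; apply: valP.
have [g gP] := linear_of_rel rtot r0 rD.
have gE x : g (\pi_(lquot rT) x) = f (val x) by apply/gP; exists x.
apply: (@irreducible_transport (subquotient S T) X g) => //.
- move=> u n q; rewrite -[q]reprK; set x : subspace S := repr q.
  transitivity (g (\pi_(lquot rT)
      (act_Y (a := sub_action (@gs_stable _ _ _ S)) u n x))); first by rewrite -actB.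
  by rewrite !gE /= fm //; apply: valP.
- move=> q; rewrite -[q]reprK gE => fx; apply/lquot_pi_eq0; rewrite rTE.
  by apply/fker; split=> //; apply: valP.
- move=> y; have [x xS <-] := fsur y.
  by exists (\pi_(lquot rT) (Sub x xS : subspace S)); rewrite gE.
Qed.

Lemma simple_step_sub A (S T : submodClosed A) : simple_step S T -> {subset T <= S}.
Proof. by move=> [_ [X _ [f [_ _ fker]]]] x /fker[]. Qed.

Lemma composition_chain_sub A l (S T : submodClosed A) :
  composition_chain l S T -> {subset T <= S}.
Proof.
elim: l S => [S <- //|l IH S [S' /simple_step_sub S'S /IH TS'] x /TS' /S'S //].
Qed.

Lemma has_lengthP A l : is_gen_module A ->
  has_length A l <-> composition_chain l (full_sub A) (zero_sub A).
Proof.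
move=> gA; split=> [[F [F0 Fl Fstep]]|].
  have <- : gs_pred (F 0%N) = full_sub A.
    by apply: submod_ext => x; rewrite in_full F0.
  have <- : gs_pred (F l) = zero_sub A.
    apply: submod_ext => x; apply/idP/idP => [/Fl/in_zero //|/in_zero ->].
    exact: rpred0.
  have H k j : (j + k = l)%N -> composition_chain k (F j) (F l).
    elim: k j => [|k IH] j jk; first by rewrite -jk addn0.
    have [|sub irr] := Fstep j; first by rewrite -jk addnS ltnS leq_addr.
    exists (gs_pred (F j.+1)); first exact/simple_stepP.
    by apply: IH; rewrite addSnnS.
  exact: H.
have H : forall l S T, stable T -> composition_chain l S T ->
    exists F : nat -> submodClosed A, [/\ forall j, stable (F j), F 0%N = S,
      F l = T & forall j, (j < l)%N -> simple_step (F j) (F j.+1)].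
  elim=> [|k IH] S T sT; first by move=> ->; exists (fun=> T).
  move=> [S' SS' /(IH _ _ sT)[F [Fs F0 Fk Fstep]]].
  exists (fun j => if j is i.+1 then F i else S); split=> //.
    by case=> [|j]; [exact: SS'.1|exact: Fs].
  by case=> [|j] jk; [rewrite F0|exact: Fstep].
move=> /(H _ _ _ (zero_stable gA))[F [Fs F0 Fl Fstep]].
exists (fun j => gen_submodule_of gA (Fs j)); split.
- by move=> w; rewrite /= F0 in_full.
- by move=> w; rewrite /= Fl => /in_zero.
- move=> j jl; have sub := simple_step_sub (Fstep _ jl).
  by split=> //; apply/simple_stepP => //; exact: Fstep.
Qed.

Lemma irreducible_chain X : irreducible_module X ->
  composition_chain 1 (full_sub X) (zero_sub X).
Proof.
move=> irX; exists (zero_sub X) => //; split; first exact: full_stable.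
exists X => //; exists id; split=> //; first by move=> y; exists y; rewrite ?in_full.
by move=> x; rewrite in_full; split=> [/in_zero|[_ /in_zero]].
Qed.

Lemma composition_chain_cat A k l (S T U : submodClosed A) :
  composition_chain k S T -> composition_chain l T U ->
  composition_chain (k + l) S U.
Proof.
elim: k S => [S -> //|k IH S [S' SS' S'T] TU]; exists S' => //.
exact: IH.
Qed.

(** Composing each factor map with [f] keeps it onto, since [f] reaches all of [S]. *)
Lemma composition_chain_preim A B (f : {linear A -> B}) l
    (S T : submodClosed B) : module_map f ->
  {in S, forall y, exists x, f x = y} -> composition_chain l S T ->
  composition_chain l (preim_sub f S) (preim_sub f T).
Proof.
move=> mf; elim: l S => [S _ -> //|l IH S onto [S' SS' S'T]].
exists (preim_sub f S'); last first.
  by apply: IH => // y yS'; apply: onto; apply: simple_step_sub yS'.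
have [sS [X irX [g [[gl gm] gsur gker]]]] := SS'.
split; first exact: preim_stable.
exists X => //; exists (g \o f); split; first split.
- by move=> a x y /in_preim xS /in_preim yS; rewrite /= linearP gl.
- by move=> u n x /in_preim xS; rewrite /= mf gm.
- move=> z; have [y yS <-] := gsur z; have [x xy] := onto y yS.
  by exists x; [apply/in_preim; rewrite xy|rewrite /= xy].
- move=> x; split=> [/in_preim /gker[fS fx]|[/in_preim xS gx]].
    by split=> //; apply/in_preim.
  by apply/in_preim/gker.
Qed.

(* [k < l] unless [K] meets every factor of the chain, that is, unless
   [S <= K + T]. *)
Lemma composition_chain_cap A (K : submodClosed A) l (S T : submodClosed A) :
  is_gen_module A -> stable K -> composition_chain l S T ->
  exists k, [/\ (k <= l)%N, composition_chain k (cap_sub S K) (cap_sub T K) &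
    k = l -> {in S, forall s, exists2 x, x \in K & s - x \in T}].
Proof.
move=> gA sK; elim: l S => [S ->|l IH S [S' SS' S'T]].
  by exists 0%N; split=> // _ s sT; exists 0; rewrite ?rpred0 ?subr0.
have [k [kl chain tight]] := IH _ S'T.
have [sS [X irX [f [[fl fm] fsur fker]]]] := SS'.
have [gX _ _] := irX.1.
have f0 : f 0 = 0 by have [] := (fker 0).1 (rpred0 _).
(* The image of [S] intersected with [K] in the factor [X] is a submodule: if it is zero the step
   collapses, if it is [X] the step survives. *)
have [Y YP] : {Y : submodClosed X | forall y, y \in Y <->
    exists2 x, x \in cap_sub S K & f x = y}.
  apply: subspace_of => [|a _ _ [u uS <-] [v vS <-]].
    by exists 0; rewrite ?rpred0 ?f0.
  have /in_cap[uS' _] := uS; have /in_cap[vS' _] := vS.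
  by exists (a *: u + v); rewrite ?fl ?rpredD ?rpredZ.
have sY : stable Y.
  move=> u n y /YP[x xSK <-]; apply/YP; have /in_cap[xS _] := xSK.
  by exists (act_Y u n x); [exact: cap_stable|rewrite fm].
case: (irreducible_stable irX sY) => EY.
  have E : cap_sub S' K = cap_sub S K.
    apply: submod_ext => x; apply/idP/idP => /in_cap[xS xK]; apply/in_cap.
      by split=> //; apply: simple_step_sub xS.
    split=> //; apply/fker; split=> //; apply/in_zero; rewrite -EY; apply/YP.
    by exists x => //; apply/in_cap.
  exists k; split; rewrite -?E //; first exact: leqW.
  by move=> kE; rewrite kE ltnn in kl.
have onto y : exists2 x, x \in cap_sub S K & f x = y.
  by apply/YP; rewrite EY in_full.
exists k.+1; split=> //.
  exists (cap_sub S' K) => //; split; first exact: cap_stable.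
  exists X => //; exists f; split=> //; first split.
  - by move=> a x y /in_cap[xS _] /in_cap[yS _]; apply: fl.
  - by move=> u n x /in_cap[xS _]; apply: fm.
  - move=> x; split=> [/in_cap[/fker[xS fx] xK]|[/in_cap[xS xK] fx]].
      by split=> //; apply/in_cap.
    by apply/in_cap; split=> //; apply/fker.
(* With no step lost, subtracting from [s] a vector of [K] with the same image in [X] moves it into
   [S'], where [tight] applies. *)
move=> [kE] s sS'; have [x /in_cap[xS xK] fx] := onto (f s).
have [|y yK yT] := tight kE (s - x).
  apply/fker; split; first exact: submodB.
  by rewrite addrC -scaleN1r fl // scaleN1r fx addNr.
by exists (x + y); [exact: rpredD|rewrite opprD addrA].
Qed.

(** The pulled-back chain of [A] descends to the kernel of the first projection; the pulled-back
    chain of [B], cut with that kernel, continues to zero. *)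
Lemma prod_chain A B k l : is_gen_module A -> is_gen_module B ->
  composition_chain k (full_sub A) (zero_sub A) ->
  composition_chain l (full_sub B) (zero_sub B) ->
  exists n, composition_chain n (full_sub (prod_action A B)) (zero_sub (prod_action A B)).
Proof.
move=> gA gB cA cB; have gAB := prod_action_gen gA gB.
pose f : {linear prod_action A B -> A} := (fst : A * B -> A).
pose g : {linear prod_action A B -> B} := (snd : A * B -> B).
have mf : module_map f by []. have mg : module_map g by [].
have onto_f : {in full_sub A, forall y, exists x, f x = y}.
  by move=> y _; exists (y, 0).
have onto_g : {in full_sub B, forall y, exists x, g x = y}.
  by move=> y _; exists (0, y).
have cf := composition_chain_preim mf onto_f cA.
have [n [_ cg _]] := composition_chain_cap gAB
  (preim_stable mf (zero_stable gA)) (composition_chain_preim mg onto_g cB).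
exists (k + n)%N; apply: (composition_chain_cat (T := preim_sub f (zero_sub A))).
  rewrite (_ : full_sub _ = preim_sub f (full_sub A)) //.
  by apply: submod_ext => x; rewrite in_full; symmetry; apply/in_preim/in_full.
rewrite (_ : preim_sub f _ = cap_sub (preim_sub g (full_sub B)) (preim_sub f (zero_sub A))).
  rewrite (_ : zero_sub _ = cap_sub (preim_sub g (zero_sub B)) (preim_sub f (zero_sub A))) //.
  apply: submod_ext => x; apply/idP/idP.
    by move=> /in_zero ->; apply: rpred0.
  move=> /in_cap[/in_preim/in_zero gx /in_preim/in_zero fx]; apply/in_zero.
  by case: x gx fx => x y /= -> ->.
apply: submod_ext => x; apply/idP/idP => [xf|/in_cap[] //].
by apply/in_cap; split=> //; apply/in_preim/in_full.
Qed.

End Submodules.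

(** * Commutators, weights and cyclic submodules *)

Section Binomials.
Variable K : numFieldType.

Lemma binomial_coef0 (a : K) : binomial_coef a 0 = 1.
Proof. by rewrite /binomial_coef big_ord0 divr1. Qed.

Lemma binomial_coef1 (a : K) : binomial_coef a 1 = a.
Proof. by rewrite /binomial_coef big_ord1 subr0 divr1. Qed.

Lemma binomial_coefS (a : K) i :
  binomial_coef a i.+1 = (i.+1%:R)^-1 * ((a - i%:R) * binomial_coef a i).
Proof.
rewrite /binomial_coef big_ord_recr /= factS natrM invfM.
by ring.
Qed.

Lemma binomial_coef_small (n i : nat) : (n < i)%N -> binomial_coef (n%:R : K) i = 0.
Proof.
by move=> ni; rewrite /binomial_coef (bigD1 (Ordinal ni)) //= subrr !mul0r.
Qed.

End Binomials.

Section Modes.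
Variables (R : realType) (V : voa R).
Local Notation omega := (voa_omega V).

(** The Jacobi identity at [l = 0]: on the left only the terms [i = 0] survive, on the right the
    binomials vanish for [i > m]. *)
Lemma commutator_formula (M : action V) (u v : V) (m : nat) (n : int) (w : M) :
  is_gen_module M ->
  act_Y u m (act_Y v n w) - act_Y v n (act_Y u m w) =
  \sum_(i < m.+1) binomial_coef (m%:R : R[i]) i *:
     act_Y (voa_Y u i%:Z v) (m%:Z + n - i%:Z) w.
Proof.
move=> gM; have [k0] := gen_module_jacobi gM u v w 0 m n.
move/(_ _ (leq_addr m.+1 k0)); rewrite addnC /jacobi_lhs /jacobi_rhs.
rewrite [in X in _ = X]big_split_ord /= [X in _ = _ + X]big1 ?addr0; last first.
  move=> i _; rewrite (binomial_coef_small R[i] (_ : m < _)%N) ?scale0r //.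
  by rewrite ltnS leq_addr.
rewrite addSn !big_ord_recl /= !binomial_coef0 !expr0 expr0z !mul1r !scale1r.
have [e1 e2] : n + 0%:Z = n /\ m%:Z + 0%:Z = m%:Z by split; apply: addr0.
rewrite e1 e2 !add0r !subr0 => <-.
rewrite !big1 ?addr0 // => i _;
by rewrite (binomial_coef_small R[i] (_ : 0 < _)%N) ?mulr0 ?scale0r.
Qed.

Lemma voa_gr_sum_ind (P : V -> Prop) :
  P 0 -> (forall a u v, P u -> P v -> P (a *: u + v)) ->
  (forall d u, u \in voa_gr V d -> P u) -> forall u, P u.
Proof.
by move=> P0 PD PA; apply: (@direct_sum_ind _ _ _ (@voa_gr R V) (@voa_grading R V)).
Qed.

(** Makes the commutator formulas for modules applicable inside [V]. *)
Definition adjoint : action V := @Action R V V (@voa_Y R V).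

Lemma adjoint_gen : is_gen_module adjoint.
Proof.
have lA : linear (@L0 R V adjoint) by apply: (voa_bilinear V).2.
split.
- apply/(gen_eigen_direct_sum lA); apply: voa_gr_sum_ind => [|a u v [r ur] [s vs]|d u ud].
  + by exists [::].
  + exists (r ++ s); rewrite (shifts_linear lA) (shifts_catl lA _ ur).
    by rewrite (shifts_catr lA _ vs) scaler0 addr0.
  + by exists [:: d%:~R]; rewrite shifts_cons /L0 /= (voa_L0 ud) subrr.
- exact: voa_bilinear.
- exact: voa_truncation.
- exact: voa_vacuum.
- exact: voa_jacobi.
- exact: voa_virasoro.
- exact: voa_derivative.
Qed.

(** The components of [L(0) v - d v] are [(i - d) h i], so uniqueness of the decomposition removes
    those of degree other than [d]. *)
Lemma voa_gr_L0 d (v : V) : voa_Y omega 1 v = d%:~R *: v -> v \in voa_gr V d.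
Proof.
move=> vd; have [s [h [us hA h0 vE]]] :=
  @direct_sum_decomp _ _ _ (@voa_gr R V) (@voa_grading R V) v.
pose g i := (i - d)%:~R *: h i.
have g0 : \sum_(i <- s) g i = 0.
  have -> : \sum_(i <- s) g i = voa_Y omega 1 v - d%:~R *: v; last by rewrite vd subrr.
  pose L : {linear V -> V} :=
    HB.pack (voa_Y omega 1) (GRing.isLinear.Build _ V V _ _ ((voa_bilinear V).2 omega 1)).
  rewrite -[voa_Y _ _ _]/(L v) vE linear_sum scaler_sumr -sumrB.
  apply: eq_bigr => i _; rewrite /= (voa_L0 (hA i)) -scalerBl /g.
  by rewrite rmorphB.
rewrite vE; apply: rpred_sum => i _.
have /eqP : g i = 0.
  apply: (@direct_sum_uniq _ _ _ (@voa_gr R V) (@voa_grading R V) s g us _ _ g0) => j.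
    by rewrite rpredZ.
  by move=> /h0; rewrite /g => ->; rewrite scaler0.
rewrite scaler_eq0 intr_eq0 subr_eq0 => /orP[/eqP <- //|/eqP ->].
exact: rpred0.
Qed.

Variable M : action V.
Hypothesis gM : is_gen_module M.

Let Y0l n (w : M) : act_Y 0 n w = 0.
Proof. by apply: (linear_at0 (f := fun u => act_Y u n w)); apply: (gm_bilinear gM).1. Qed.

Let YZl a u n (w : M) : act_Y (a *: u) n w = a *: act_Y u n w.
Proof. by have := (gm_bilinear gM).1 n w a u 0; rewrite Y0l !addr0. Qed.

Lemma commutator_L0 d (u : V) n (w : M) : u \in voa_gr V d ->
  act_Y omega 1 (act_Y u n w) - act_Y u n (act_Y omega 1 w) =
  (d - n - 1)%:~R *: act_Y u n w.
Proof.
move=> ud; have := commutator_formula omega u 1 n w gM => ->.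
rewrite big_ord_recl big_ord1 /= binomial_coef0 binomial_coef1 !scale1r.
have -> : 1%:Z + n - 0%:Z = 1 + n by apply: subr0.
rewrite (gm_derivative gM) (voa_L0 ud) YZl.
have -> : 1 + n - 1 = n by lia.
set a := (X in _ + _ *: act_Y u X w); have -> : a = n by rewrite /a /bump /=; lia.
rewrite -scaleNr -scalerDl -rmorphN -rmorphD /=.
by congr (_%:~R *: _); lia.
Qed.

Lemma commutator_Lm1 (u : V) n (w : M) :
  act_Y omega 0 (act_Y u n w) - act_Y u n (act_Y omega 0 w) =
  - (n%:~R *: act_Y u (n - 1) w).
Proof.
have := commutator_formula omega u 0 n w gM => ->.
have e : 0%:Z + n - 0%:Z = n by lia.
by rewrite big_ord1 /= binomial_coef0 scale1r e (gm_derivative gM).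
Qed.

Lemma commutator_L1 d (u : V) n (w : M) : u \in voa_gr V d ->
  act_Y omega 2 (act_Y u n w) - act_Y u n (act_Y omega 2 w) =
  (2 * d - n - 2)%:~R *: act_Y u (n + 1) w + act_Y (voa_Y omega 2 u) n w.
Proof.
move=> ud; have := commutator_formula omega u 2 n w gM => ->.
rewrite !big_ord_recl big_ord0 /= /bump /= addr0.
have b2 : binomial_coef (2%:R : R[i]) 2 = 1.
  by rewrite binomial_coefS binomial_coef1 [2 - 1](_ : _ = 1) ?mul1r ?mulVf ?pnatr_eq0 //;
    rewrite -[2]/(1 + 1) addrK.
rewrite b2 binomial_coef0 binomial_coef1 !scale1r (gm_derivative gM) (voa_L0 ud) YZl.
set a0 := (X in - (X%:~R *: _)); have -> : a0 = n + 2 by rewrite /a0 /=; lia.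
set a1 := (X in _ *: (_ *: act_Y u X w)); have -> : a1 = n + 1.
  by rewrite /a1 /=; lia.
rewrite [X in _ + (_ + X)]addr0.
set a2 := (X in _ + (_ + act_Y _ X w)); have -> : a2 = n by rewrite /a2 /=; lia.
set a3 := (X in - (_ *: act_Y u X w)); have -> : a3 = n + 1 by rewrite /a3 /=; lia.
rewrite addrA; congr (_ + _).
rewrite scalerA -scaleNr -scalerDl; congr (_ *: _).
have -> : 2 * d - n - 2 = 2%:Z * d - (n + 2) by lia.
by rewrite rmorphB rmorphM addrC.
Qed.

(** [u_n] intertwines [L(0) - mu] with [L(0) - (mu + d - n - 1)], so the nilpotency exponent is
    preserved. *)
Lemma act_weight mu d u n (w : M) : u \in voa_gr V d -> w \in @weight_space R V M mu ->
  act_Y u n w \in @weight_space R V M (mu + (d - n - 1)%:~R).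
Proof.
move=> ud /gen_eigenP[k wk]; apply/gen_eigenP; exists k.
suff H x : shifts (@L0 R V M) (nseq k (mu + (d - n - 1)%:~R)) (act_Y u n x) =
    act_Y u n (shifts (@L0 R V M) (nseq k mu) x) by rewrite H wk act_Y0.
elim: k x {wk} => [//|k IH] x; rewrite !shifts_cons -IH; congr shifts.
have/eqP := commutator_L0 n x ud; rewrite subr_eq => /eqP; rewrite /L0 => ->.
rewrite act_YB // -[mu *: x]addr0 act_YP // act_Y0 // addr0.
by rewrite scalerDl [mu *: _ + _]addrC opprD addrACA subrr add0r.
Qed.

End Modes.

Section VoaWeights.
Variables (R : realType) (V : voa R).
Local Notation omega := (voa_omega V).

Lemma voa_gr_act d e (u v : V) n : u \in voa_gr V d -> v \in voa_gr V e ->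
  voa_Y u n v \in voa_gr V (d + e - n - 1).
Proof.
move=> ud ve; apply: voa_gr_L0.
have /eqP := commutator_L0 (adjoint_gen V) n (v : adjoint V) ud.
rewrite subr_eq /= (voa_L0 ve) => /eqP ->.
have YZ a : voa_Y u n (a *: v) = a *: voa_Y u n v.
  have := (voa_bilinear V).2 u n a v 0.
  by rewrite (linear_at0 ((voa_bilinear V).2 u n)) !addr0.
rewrite YZ -scalerDl -rmorphD /=; congr (_%:~R *: _); lia.
Qed.

End VoaWeights.

Section Cyclic.
Variables (R : realType) (V : voa R) (M : action V).
Hypothesis gM : is_gen_module M.
Local Notation omega := (voa_omega V).

(** Single modes suffice for the generated submodule, products of modes being absorbed by
    [act2_in_cyc]. *)
Definition cyc (m : M) : submodClosed M :=
  lspan [set x : M | exists u n, x = act_Y u n m].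

Lemma act_in_cyc u n (m : M) : act_Y u n m \in cyc m.
Proof. by apply: lspan_gen; exists u, n. Qed.

Lemma mem_cyc (m : M) : m \in cyc m.
Proof. by have := act_in_cyc (voa_vac V) (-1) m; rewrite (gm_vacuum gM). Qed.

Lemma cyc_min (S : submodClosed M) m : stable S -> m \in S -> {subset cyc m <= S}.
Proof. by move=> sS mS; apply: lspan_min => _ [u [n ->]]; apply: sS. Qed.

(* The Jacobi identity with [l + m = k] and [u_{m + i} w = 0] for [i >= 0]
   expresses [u_k v_n w] through modes acting on [w] and through the
   [u_{k - i} v_{n + i} w], [i > 0]; the latter vanish for large [n]. *)
Lemma act2_in_cyc u k v n (w : M) : act_Y u k (act_Y v n w) \in cyc w.
Proof.
have [N NP] := gm_truncation gM v w.
(* [t] measures how far [n] may lie below the bound from which [v_n w = 0]. *)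
suff H t : forall k n, N - t%:Z <= n -> act_Y u k (act_Y v n w) \in cyc w.
  by apply: (H `|N - n|%N); lia.
elim: t => [|t IH] {}k {}n Nn.
  by rewrite NP ?act_Y0 ?rpred0 //; lia.
have [M0 M0P] := gm_truncation gM u w.
have [k0 /(_ k0.+1 (leqnSn _))] := gen_module_jacobi gM u v w (k - M0) M0 n.
rewrite /jacobi_lhs /jacobi_rhs [X in _ - X]big1 ?subr0; last first.
  by move=> i _; rewrite M0P ?act_Y0 ?scaler0 //; lia.
rewrite big_ord_recl /= expr0 mul1r binomial_coef0 scale1r.
have -> : k - M0 + M0 - 0%:Z = k by lia.
have -> : n + 0%:Z = n by lia.
move=> /(canRL (addrK _)) ->; apply: submodB; apply: rpred_sum => i _; apply: rpredZ.
  exact: act_in_cyc.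
by apply: IH; rewrite /bump /=; lia.
Qed.

Lemma cyc_stable m : stable (cyc m).
Proof.
move=> u n w; move: w; apply: lspan_ind => [|a x y xm ym|_ [v [k ->]]].
- by rewrite act_Y0 // rpred0.
- by rewrite act_YP // rpredD ?rpredZ.
- exact: act2_in_cyc.
Qed.

Definition cyc_part (mu : R[i]) (m : M) (a : R[i]) : submodClosed M :=
  lspan [set x : M | exists d u n, [/\ u \in voa_gr V d,
    mu + (d - n - 1)%:~R = a & x = act_Y u n m]].

(** Sorting the modes by weight writes [w] as a vector of [cyc_part] plus a rest killed by some [r]
    avoiding [a]; the rest also has weight [a], hence is zero. *)
Lemma cyc_partP mu m a w : m \in @weight_space R V M mu ->
  w \in cyc m -> w \in @weight_space R V M a -> w \in cyc_part mu m a.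
Proof.
move=> mmu wm wa; have lM := L0_linear gM.
have partW x : x \in cyc_part mu m a -> x \in @weight_space R V M a.
  have [Z ZP] : {Z : submodClosed M | forall x, x \in Z <-> x \in @weight_space R V M a}.
    have [W0 WD] := gen_eigen_submod lM a.
    by apply: subspace_of => [|b u v]; [exact: W0|exact: WD].
  move=> xa; apply/ZP; move: x xa; apply: lspan_min => _ [d [u [n [ud e ->]]]].
  by apply/ZP; rewrite -e; apply: act_weight.
pose P x := exists x1 x2 r, [/\ x = x1 + x2, x1 \in cyc_part mu m a, a \notin r
  & shifts (@L0 R V M) r x2 = 0].
have PD b x y : P x -> P y -> P (b *: x + y).
  move=> [x1 [x2 [r [-> x1a ar x2r]]]] [y1 [y2 [s [-> y1a as_ y2s]]]].
  exists (b *: x1 + y1), (b *: x2 + y2), (r ++ s); split.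
  - by rewrite scalerDr addrACA.
  - by rewrite rpredD ?rpredZ.
  - by rewrite mem_cat negb_or ar.
  - rewrite (shifts_linear lM) (shifts_catl lM _ x2r).
    by rewrite (shifts_catr lM _ y2s) scaler0 addr0.
have P0 : P 0 by exists 0, 0, [::]; rewrite addr0 rpred0.
have Pgen u n : P (act_Y u n m).
  move: u; apply: voa_gr_sum_ind => [|b u v Pu Pv|d u ud].
  - by rewrite (linear_at0 (f := fun u => act_Y u n m)) //; apply: (gm_bilinear gM).1.
  - by rewrite (gm_bilinear gM).1; apply: PD.
  - have [e|ne] := eqVneq (mu + (d - n - 1)%:~R) a.
      exists (act_Y u n m), 0, [::]; rewrite addr0; split=> //.
      by apply: lspan_gen; exists d, u, n.
    have [k mk] := (gen_eigenP _ _ _).1 (act_weight gM n ud mmu).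
    exists 0, (act_Y u n m), (nseq k (mu + (d - n - 1)%:~R)).
    by rewrite add0r rpred0 mem_nseq negb_and eq_sym ne orbT.
have [x1 [x2 [r [wE x1a ar x2r]]]] : P w.
  by move: w wm {wa}; apply: lspan_ind => // _ [u [n ->]].
have x2a : x2 \in @weight_space R V M a.
  have -> : x2 = (-1) *: x1 + w by rewrite wE scaleN1r addKr.
  by apply: (gen_eigen_submod lM a).2 => //; apply: partW.
by rewrite wE (gen_eigen_coprime lM x2a x2r ar) addr0.
Qed.

Lemma cyc_weight mu m a w : m \in @weight_space R V M mu ->
  w \in cyc m -> w \in @weight_space R V M a -> w != 0 ->
  exists j : int, a = mu + j%:~R.
Proof.
move=> mmu wm wa /eqP w0; apply: contrapT => noj; apply: w0.
have := cyc_partP mmu wm wa; move: {wm wa}w; apply: lspan_ind.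
- by [].
- by move=> b u v -> ->; rewrite scaler0 addr0.
- by move=> x [d [u [n [_ e _]]]]; case: noj; exists (d - n - 1).
Qed.

End Cyclic.

(** * Bounds on weight multiplicities in cyclic modules *)

Section Bounds.
Variables (R : realType) (V : voa R).
Local Notation omega := (voa_omega V).

Lemma ReD (x y : R[i]) : complex.Re (x + y) = complex.Re x + complex.Re y.
Proof. by case: x y => [a b] [c d]. Qed.

Lemma Re_int (j : int) : complex.Re (j%:~R : R[i]) = j%:~R.
Proof. by rewrite -[j%:~R in LHS](rmorph_int (real_complex R)). Qed.

Lemma binomial_op_eigen (A : {linear V -> V}) a i v :
  A v = a *: v -> binomial_op A i v = binomial_coef a i *: v.
Proof.
move=> Av; elim: i => [|i IH]; first by rewrite binomial_coef0 scale1r.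
rewrite /= IH binomial_coefS linearZ /= Av; move: (binomial_coef a i) => c.
by rewrite -scalerA mulrBl scalerBl [a * c]mulrC !scalerA.
Qed.

Lemma binomial_op_linear (A : {linear V -> V}) i : linear (binomial_op A i).
Proof.
elim: i => [//|i IH] a u v /=; rewrite IH linearP.
rewrite [a *: (_ *: _)]scalerA [a * _]mulrC -scalerA -scalerDr; congr (_ *: _).
by rewrite scalerDr opprD addrACA scalerBr !scalerA [a * _]mulrC.
Qed.

Definition no_weight_below (M : action V) (B : R) : Prop :=
  forall n (w : M), w \in @weight_space R V M n -> complex.Re n < B -> w = 0.

Lemma no_weight_below_le (M : action V) (B C : R) :
  C <= B -> no_weight_below M B -> no_weight_below M C.
Proof. by move=> CB MB n w wn nC; apply: (MB n) => //; apply: lt_le_trans CB. Qed.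

(** The map [u |-> o(u) m]: on degree [d] the mode of index [d - 1] is the one that preserves
    weights. *)
Lemma zero_mode_exists (M : action V) (m : M) : is_gen_module M ->
  {f : {linear V -> M} | forall d u, u \in voa_gr V d -> f u = act_Y u (d - 1) m}.
Proof.
move=> gM; apply: (@direct_sum_linear _ _ _ (@voa_gr R V) (@voa_grading R V) M
  (fun d u => act_Y u (d - 1) m)) => d.
exact: (gm_bilinear gM).1.
Qed.

Section ZeroMode.
Variables (N : nat) (M : action V) (mu : R[i]) (m : M).
Hypotheses (gM : is_gen_module M) (m_mu : m \in @weight_space R V M mu).
Hypothesis low : no_weight_below M (complex.Re mu - N%:R).
Variable o : {linear V -> M}.
Hypothesis oE : forall d u, u \in voa_gr V d -> o u = act_Y u (d - 1) m.

(** Such a mode lowers the weight by [n + 1 - d > N]. *)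
Lemma lower_mode_zero d (u : V) n : u \in voa_gr V d -> d + N%:Z <= n ->
  act_Y u n m = 0.
Proof.
move=> ud dn; apply: (low (act_weight gM n ud m_mu)).
rewrite ReD Re_int ltrD2l -[N%:R]/(N%:~R) -rmorphN /= ltr_int; lia.
Qed.

(** For [u], [v] of degrees [d], [e], take the Jacobi identity at [l = -(2N+2)], [m = d+N],
    [n = e+N]. Each term on the left contains a mode killing [m]; on the right [m + n - i] is the
    zero mode index of [u_(l+i) v]. *)
Lemma zero_mode_residue u v : o (zhu_residue (2 * N + 2) N u v) = 0.
Proof.
have Blin : linear (fun x : V => voa_Y omega 1 x + N%:R *: x).
  move=> a x y; rewrite (voa_bilinear V).2 scalerDr addrACA scalerDr !scalerA.
  by rewrite mulrC.
pose B : {linear V -> V} := HB.pack (fun x : V => voa_Y omega 1 x + N%:R *: x)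
  (GRing.isLinear.Build R[i] V V *:%R _ Blin).
pose t u v i := voa_Y (binomial_op B i u) (i%:Z - (2 * N + 2)%:Z) v.
(* Carrying the cut-off along makes the claim additive in [u] and [v], which reduces it to
   homogeneous vectors. *)
pose T u v := exists k0 : nat, (forall i, (k0 <= i)%N -> t u v i = 0) /\
  forall k, (k0 <= k)%N -> o (\sum_(i < k) t u v i) = 0.
suff [k0 [t0 Tk]] : T u v by rewrite /zhu_residue (fsbig_nat t0) Tk.
have t0l i y : t 0 y i = 0.
  rewrite /t (linear_at0 (binomial_op_linear B i)).
  by apply: (linear_at0 (f := fun x => voa_Y x _ y)); apply: (voa_bilinear V).1.
have t0r i x : t x 0 i = 0 by apply: linear_at0; apply: (voa_bilinear V).2.
have tl a x x' y i : t (a *: x + x') y i = a *: t x y i + t x' y i.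
  by rewrite /t binomial_op_linear (voa_bilinear V).1.
have tr a x y y' i : t x (a *: y + y') i = a *: t x y i + t x y' i.
  by rewrite /t (voa_bilinear V).2.
have comb (a : R[i]) x y x' y' x2 y2 :
    (forall i, t x2 y2 i = a *: t x y i + t x' y' i) ->
    T x y -> T x' y' -> T x2 y2.
  move=> E [k [kP ks]] [l [lP ls]]; exists (k + l)%N; split=> i kli.
    rewrite E kP ?lP ?scaler0 ?addr0 //.
      exact: leq_trans (leq_addl _ _) kli.
    exact: leq_trans (leq_addr _ _) kli.
  under eq_bigr do rewrite E.
  rewrite big_split -scaler_sumr linearP ks ?ls ?scaler0 ?addr0 //.
    exact: leq_trans (leq_addl _ _) kli.
  exact: leq_trans (leq_addr _ _) kli.
move: u; apply: voa_gr_sum_ind => [|a x y Tx Ty|d u ud].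
- by exists 0%N; split=> // k _; rewrite big1 ?linear0.
- by apply: comb Tx Ty => i; apply: tl.
move: v; apply: voa_gr_sum_ind => [|a x y Tx Ty|e v ve].
- by exists 0%N; split=> // k _; rewrite big1 ?linear0.
- by apply: comb Tx Ty => i; apply: tr.
have Bu : B u = (d + N%:Z)%:~R *: u.
  by rewrite /= (voa_L0 ud) -scalerDl rmorphD.
pose l : int := - (2 * N + 2)%:Z.
have tE i : t u v i = binomial_coef ((d + N%:Z)%:~R : R[i]) i *: voa_Y u (l + i%:Z) v.
  have li : i%:Z - (2 * N + 2)%:Z = l + i%:Z by rewrite addrC.
  rewrite /t (binomial_op_eigen i Bu) li.
  have := (voa_bilinear V).1 (l + i%:Z) v (binomial_coef (d + N%:Z)%:~R i) u 0.
  by rewrite (linear_at0 ((voa_bilinear V).1 _ v)) !addr0.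
have [k1 k1P] := truncation_nat u v l (@voa_truncation R V).
have [k2 k2P] := gen_module_jacobi gM u v m l (d + N%:Z) (e + N%:Z).
exists (k1 + k2)%N; split=> [i ki|k kk].
  by rewrite tE k1P ?scaler0 //; apply: leq_trans ki; apply: leq_addr.
have {k2P} := k2P k (leq_trans (leq_addl _ _) kk).
have -> : jacobi_lhs (@act_Y R V M) u v m l (d + N%:Z) (e + N%:Z) k = 0.
  rewrite /jacobi_lhs !big1 ?subrr // => i _.
    rewrite (lower_mode_zero ud) ?act_Y0 ?scaler0 //; lia.
  rewrite (lower_mode_zero ve) ?act_Y0 ?scaler0 //; lia.
move=> E; rewrite [RHS]E /jacobi_rhs linear_sum; apply: eq_bigr => i _.
rewrite tE linearZ /= (oE (voa_gr_act _ ud ve)); congr (_ *: act_Y _ _ _).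
rewrite /l; lia.
Qed.

(** For the generators [L(-1)u + L(0)u] with [u] of degree [d], the derivative property gives
    [o(L(-1)u) = - d o(u)], which cancels [o(L(0)u)]. *)
Lemma zero_mode_zhu_O u : u \in zhu_O V N -> o u = 0.
Proof.
move=> uO; apply/in_zero/in_preim; move: u uO; apply: lspan_min => w [].
  by move=> [u [v ->]]; apply/in_preim/in_zero/zero_mode_residue.
move=> [u ->]; apply/in_preim/in_zero.
move: u; apply: voa_gr_sum_ind => [|a x y ox oy|d u ud].
- by rewrite !(linear_at0 ((voa_bilinear V).2 _ _)) addr0 linear0.
- by rewrite !(voa_bilinear V).2 addrACA -scalerDr linearP ox oy scaler0 addr0.
have := voa_gr_act 0 (voa_omega_gr V) ud; rewrite linearD (voa_L0 ud) linearZ.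
move=> /oE -> /=; rewrite (oE ud) (gm_derivative gM).
have -> : 2 + d - 0 - 1 - 1 = d by lia.
by rewrite addNr.
Qed.

End ZeroMode.

(** [P] need not be a subspace, so sources of spanning vectors combine by disjunction; [D] is
    separate from the list so that it can be chosen before [M]. *)
Definition spanned_by (M : lmodType R[i]) (D : nat) (P : M -> Prop) : Prop :=
  exists s : seq M, (size s <= D)%N /\ forall w, P w -> w \in lspan [set` s].

Lemma zhu_bound N : zhu_finite_dim V N -> exists D : nat,
  forall (M : action V) mu (m : M), is_gen_module M ->
    m \in @weight_space R V M mu ->
    no_weight_below M (complex.Re mu - N%:R) ->
    spanned_by D (fun w => w \in cyc m /\ w \in @weight_space R V M mu).
Proof.
move=> [s sP]; exists (size s) => M mu m gM mmu low.
have [o oE] := zero_mode_exists m gM.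
(* Representatives may be chosen freely, their differences lying in [O_N(V)], which [o] kills. *)
exists (map (fun q : zhu_algebra V N => o (repr (q : lquot _))) s).
rewrite size_map; split=> // w [wm wmu].
have : w \in cyc_part mu m mu by apply: cyc_partP.
move: w {wm wmu}; apply: lspan_min => _ [d [u [n [ud e ->]]]].
have {e} -> : n = d - 1.
  move/eqP: e; rewrite -subr_eq0 addrAC subrr add0r intr_eq0 => /eqP; lia.
rewrite -(oE _ _ ud) {d n ud}.
have /lspan_seqP[c uE] : \pi_(lquot (zhu_O V N)) u \in lspan [set` s] by rewrite -sP.
pose v := \sum_(i < size s) c i *: repr (s`_i : lquot (zhu_O V N)).
have : u - v \in zhu_O V N.
  apply/lquot_eqP; rewrite uE /v; symmetry.
  elim/big_rec2: _ => [|i x y _ <-]; first exact/lquot_pi_eq0/rpred0.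
  by rewrite lquot_pi_lin reprK.
move=> /(zero_mode_zhu_O gM mmu low oE); rewrite linearB => /eqP.
rewrite subr_eq0 => /eqP ->; rewrite linear_sum; apply: rpred_sum => i _.
rewrite linearZ; apply: rpredZ; apply: lspan_gen; apply/mapP.
by exists s`_i => //; apply: mem_nth.
Qed.

Lemma spanned_by_cat (M : lmodType R[i]) D E (P Q : M -> Prop) :
  spanned_by D P -> spanned_by E Q -> spanned_by (D + E) (fun w => P w \/ Q w).
Proof.
move=> [s [sD sP]] [t [tE tQ]]; exists (s ++ t).
rewrite size_cat leq_add //; split=> // w [/sP|/tQ]; apply: lspan_sub_seq => x xs.
  by rewrite mem_cat xs.
by rewrite mem_cat xs orbT.
Qed.

Lemma spanned_by_im (M N : lmodType R[i]) D (f : M -> N) (P : M -> Prop) :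
  linear f -> spanned_by D P -> spanned_by D (fun y => exists2 x, P x & f x = y).
Proof.
move=> fl [s [sD sP]]; exists (map f s); rewrite size_map; split=> // _ [x /sP + <-].
move: x; apply: lspan_ind => [|a u v fu fv|x xs].
- by rewrite (linear_at0 fl) rpred0.
- by rewrite fl rpredD ?rpredZ.
- by apply: lspan_gen; apply: map_f.
Qed.

Lemma homogeneous_spanned d : exists D, forall (M : action V) (m : M) n,
  is_gen_module M ->
  spanned_by D (fun x => exists2 u, u \in voa_gr V d & act_Y u n m = x).
Proof.
have [s sP] := @voa_finite_dim R V d; exists (size s) => M m n gM.
apply: (spanned_by_im (f := fun u => act_Y u n m)).
  exact: (gm_bilinear gM).1.
by exists s; split=> // u; rewrite sP.
Qed.

(** As the grading of [V] is bounded below, finitely many degrees are involved; they are added one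
    at a time. *)
Lemma low_degree_spanned (e k : int) : exists D, forall (M : action V) (m : M),
  is_gen_module M -> spanned_by D (fun x => exists d u,
    [/\ u \in voa_gr V d, d <= e & act_Y u (d + k) m = x]).
Proof.
have [N NP] := @voa_grading_bounded R V.
suff [D DP] : exists D, forall (M : action V) (m : M),
  is_gen_module M -> spanned_by D (fun x => exists d u,
    [/\ u \in voa_gr V d, d < N + (absz (e + 1 - N)%R)%:Z & act_Y u (d + k) m = x]).
  exists D => M m gM; have [s [sD sP]] := DP M m gM; exists s; split=> // x.
  move=> [d [u [ud de ux]]]; apply: sP; exists d, u; split=> //; lia.
elim: (absz (e + 1 - N)%R) => [|c [D DP]].
  exists 0%N => M m gM; exists [::]; split=> // x [d [u [ud dN <-]]].
  rewrite (NP d u) //; last by rewrite addr0 in dN.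
  by rewrite (linear_at0 ((gm_bilinear gM).1 _ _)) rpred0.
have [E EP] := homogeneous_spanned (N + c%:Z).
exists (D + E)%N => M m gM.
have [s [sD sP]] := spanned_by_cat (DP M m gM) (EP M m (N + c%:Z + k) gM).
exists s; split=> // x [d [u [ud dc ux]]]; apply: sP.
have [dE|ne] := eqVneq d (N + c%:Z); last by left; exists d, u; split=> //; lia.
by right; exists u; rewrite -dE.
Qed.

Variable N : nat.
Hypothesis zhuN : zhu_finite_dim V N.

(** The commutator of [L(-1)] with [u_(n+1)] expresses [u_n m] through [L(-1)] on the weight
    [mu + k] part of [cyc m] and through [cyc] of [L(-1) m], which again is raised by [k] only. The
    coefficient vanishes for [n = -1], that is for [d = k + 1]: one homogeneous component. The bound
    on weights is relative to the target, so it is unchanged for [L(-1) m]. *)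
Lemma raised_bound (k : nat) : exists D : nat,
  forall (M : action V) mu (m : M), is_gen_module M ->
    m \in @weight_space R V M mu ->
    no_weight_below M (complex.Re mu + k%:R - N%:R) ->
    spanned_by D (fun w => w \in cyc m /\ w \in @weight_space R V M (mu + k%:R)).
Proof.
elim: k => [|k [D IH]].
  have [D DP] := zhu_bound zhuN; exists D => M mu m gM mmu low.
  by rewrite addr0; apply: DP => //; rewrite addr0 in low.
have [E EP] := homogeneous_spanned k.+1%:Z; exists (D + D + E)%N => M mu m gM mmu low.
have low0 : no_weight_below M (complex.Re mu + k%:R - N%:R).
  by apply: no_weight_below_le low; rewrite lerD2r lerD2l ler_nat.
have Lm : act_Y omega 0 m \in @weight_space R V M (mu + 1).
  by have := act_weight gM 0 (voa_omega_gr V) mmu.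
have low1 : no_weight_below M (complex.Re (mu + 1) + k%:R - N%:R).
  have -> // : complex.Re (mu + 1) + k%:R = complex.Re mu + k.+1%:R.
  by rewrite ReD -natr1 [k%:R + 1]addrC addrA.
have B1 := spanned_by_im ((gm_bilinear gM).2 omega 0) (IH M mu m gM mmu low0).
have [s [sD sP]] := spanned_by_cat (spanned_by_cat B1 (IH M (mu + 1) _ gM Lm low1))
  (EP M m (-1) gM).
exists s; split=> // w [wm wmu].
have := cyc_partP gM mmu wm wmu; move: {wm wmu}w; apply: lspan_min.
move=> _ [d [u [n [ud e ->]]]].
have {}e : d - n - 1 = k.+1%:Z.
  by apply/eqP; rewrite -(eqr_int R[i]); apply/eqP; apply: (addrI mu).
have [dk|ndk] := eqVneq d k.+1%:Z.
  apply: sP; right; exists u; first by rewrite -dk.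
  by congr act_Y; lia.
have c0 : (- (n + 1))%:~R != 0 :> R[i] by rewrite intr_eq0; apply/eqP; lia.
have := commutator_Lm1 gM u (n + 1) m; rewrite addrK -scaleNr -rmorphN /= => E1.
rewrite -[act_Y u n m]scale1r -(mulVf c0) -scalerA -E1; apply: rpredZ; apply: submodB.
  apply: sP; left; left; exists (act_Y u (n + 1) m) => //; split.
    exact: act_in_cyc.
  have -> : k%:R = (d - (n + 1) - 1)%:~R :> R[i].
    by rewrite (_ : d - (n + 1) - 1 = k%:Z) //; lia.
  exact: act_weight.
apply: sP; left; right; split; first exact: act_in_cyc.
have -> : k%:R = (d - (n + 1) - 1)%:~R :> R[i].
  by rewrite (_ : d - (n + 1) - 1 = k%:Z) //; lia.
exact: act_weight.
Qed.

(** The relevant modes are [u_(d+k)]. In the commutator of [L(1)] with [u_(d+k-1)] the coefficient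
    of [u_(d+k)] is [d - k - 1], and [L(1) u] yields a mode of the same shape in degree [d - 1].
    Degrees up to [k + 1] are spanned separately. *)
Lemma lowered_bound (k : nat) : exists D : nat,
  forall (M : action V) mu (m : M), is_gen_module M ->
    m \in @weight_space R V M mu ->
    no_weight_below M (complex.Re mu - N%:R) ->
    spanned_by D (fun w => w \in cyc m /\ w \in @weight_space R V M (mu - k%:R)).
Proof.
elim: k => [|k [D IH]].
  have [D DP] := zhu_bound zhuN; exists D => M mu m gM mmu low.
  by rewrite subr0; apply: DP.
have [E EP] := low_degree_spanned k.+1%:Z k%:Z.
exists (D + D + E)%N => M mu m gM mmu low.
have Lm : act_Y omega 2 m \in @weight_space R V M (mu - 1).
  by have := act_weight gM 2 (voa_omega_gr V) mmu.
have low1 : no_weight_below M (complex.Re (mu - 1) - N%:R).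
  apply: no_weight_below_le low; rewrite lerD2r.
  by rewrite ReD -[-1]/((-1)%:~R) Re_int rmorphN /= gerBl ler01.
have B1 := spanned_by_im ((gm_bilinear gM).2 omega 2) (IH M mu m gM mmu low).
have [s [sD sP]] := spanned_by_cat (spanned_by_cat B1 (IH M (mu - 1) _ gM Lm low1))
  (EP M m gM).
exists s; split=> // w [wm wmu].
have := cyc_partP gM mmu wm wmu; move: {wm wmu}w; apply: lspan_min.
move=> _ [d [u [n [ud e ->]]]].
have {}e : n = d + k%:Z.
  suff : d - n - 1 = - k.+1%:Z by lia.
  apply/eqP; rewrite -(eqr_int R[i]); apply/eqP; apply: (addrI mu).
  by rewrite e rmorphN.
(* Inner induction on the excess of the degree over [k + 1], which disposes of the term [L(1) u]. *)
suff H (c : nat) : forall d u, u \in voa_gr V d -> d <= k.+1%:Z + c%:Z ->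
    act_Y u (d + k%:Z) m \in lspan [set` s].
  by rewrite e; apply: (H `|d - k.+1%:Z|%N) ud _; lia.
elim: c {d u n ud e} => [|c IHc] d u ud dc.
  by apply: sP; right; exists d, u; rewrite addr0 in dc.
have [dle|] := lerP d (k.+1%:Z + c%:Z); first exact: IHc.
move=> dgt; have c0 : (d - k.+1%:Z)%:~R != 0 :> R[i].
  by rewrite intr_eq0; apply/eqP; lia.
have := commutator_L1 gM (d + k%:Z - 1) m ud; rewrite subrK.
have -> : 2 * d - (d + k%:Z - 1) - 2 = d - k.+1%:Z by lia.
move=> /eqP; rewrite -subr_eq => /eqP E1.
have wk : (d - (d + k%:Z - 1) - 1)%:~R = - k%:R :> R[i].
  by rewrite (_ : _ - _ - 1 = - k%:Z) ?rmorphN //; lia.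
rewrite -[act_Y u _ m]scale1r -(mulVf c0) -scalerA -E1; apply: rpredZ.
apply: submodB; first apply: submodB.
- apply: sP; left; left; exists (act_Y u (d + k%:Z - 1) m) => //; split.
    exact: act_in_cyc.
  by rewrite -wk; apply: act_weight.
- apply: sP; left; right; split; first exact: act_in_cyc.
  by rewrite -wk; apply: act_weight.
- have := voa_gr_act 2 (voa_omega_gr V) ud.
  rewrite (_ : 2 + d - 2 - 1 = d - 1); last by lia.
  by move=> /IHc; rewrite addrAC; apply; lia.
Qed.

End Bounds.

(** * Weights of irreducible modules and bounds on the length *)

Section WeightMaps.
Variables (R : realType) (V : voa R).
Implicit Types (A B C X : action V).

Lemma weight_map A B (f : {linear A -> B}) a x : module_map f ->
  x \in @weight_space R V A a -> f x \in @weight_space R V B a.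
Proof.
move=> mf /gen_eigenP[k xk]; apply/gen_eigenP; exists k.
by rewrite -module_map_shifts // xk linear0.
Qed.

Lemma weight_inj A B C (f : {linear A -> B}) (g : {linear A -> C}) a x :
  is_gen_module B -> is_gen_module C -> module_map f -> module_map g ->
  (forall x, f x = 0 -> g x = 0 -> x = 0) ->
  f x \in @weight_space R V B a -> g x \in @weight_space R V C a ->
  x \in @weight_space R V A a.
Proof.
move=> gB gC mf mg inj /gen_eigenP[k xk] /gen_eigenP[l xl]; apply/gen_eigenP.
exists (k + l)%N; rewrite nseqD; apply: inj; rewrite module_map_shifts //.
  exact: (shifts_catl (L0_linear gB)).
exact: (shifts_catr (L0_linear gC)).
Qed.

Lemma partial_map_lin A X (S : submodClosed A) (f : A -> X) : partial_map S f ->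
  f 0 = 0 /\ {in S &, forall x y, f (x - y) = f x - f y}.
Proof.
move=> [fl _]; split=> [|x y xS yS].
  have := fl (-1) 0 0 (rpred0 _) (rpred0 _).
  by rewrite scaler0 addr0 scaleN1r addNr.
by rewrite addrC -scaleN1r fl // scaleN1r addrC.
Qed.

Lemma partial_map_shifts A X (S : submodClosed A) (f : A -> X) r x :
  stable S -> partial_map S f -> x \in S ->
  f (shifts (@L0 R V A) r x) = shifts (@L0 R V X) r (f x).
Proof.
move=> sS pf; have [f0 fB] := partial_map_lin pf; have [fl fm] := pf.
elim: r x => [//|a r IH] x xS; rewrite !shifts_cons IH.
  rewrite fB ?rpredZ ?sS // fm //; congr (shifts _ _ (_ - _)).
  by have := fl a x 0 xS (rpred0 _); rewrite f0 !addr0.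
by apply: submodB; [apply: sS|apply: rpredZ].
Qed.

(** Exactness of the weight space functor: of an arbitrary lift keep the component of weight [a];
    the rest has an image both of weight [a] and killed by shifts avoiding [a], hence zero. *)
Lemma partial_map_weight_onto A X (S : submodClosed A) (f : A -> X) a y :
  is_gen_module A -> is_gen_module X -> stable S -> partial_map S f ->
  (forall y, exists2 x, x \in S & f x = y) -> y \in @weight_space R V X a ->
  exists x, [/\ x \in S, x \in @weight_space R V A a & f x = y].
Proof.
move=> gA gX sS pf sur ya; have [x xS xy] := sur y.
have lA := L0_linear gA; have lX := L0_linear gX.
have [f0 fB] := partial_map_lin pf.
have [r xr] := (gen_eigen_direct_sum lA).1 (gm_grading gA) x.
have L0S : {in S, forall w, L0 w \in S} by move=> w; apply: sS.
have [v1 [v2 [xE v1S v2S v1a v2r]]] := gen_eigen_split lA L0S a xS xr.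
exists v1; split=> //; have v1E : v1 = x - v2 by rewrite xE addrK.
have fv1 : f v1 \in @weight_space R V X a.
  have [k vk] := (gen_eigenP _ _ _).1 v1a; apply/gen_eigenP; exists k.
  by rewrite -(partial_map_shifts _ sS pf v1S) vk f0.
have fv2 : f v2 = -1 *: f v1 + y.
  by rewrite v1E fB // xy scaleN1r opprB addrNK.
suff f20 : f v2 = 0 by rewrite v1E fB // xy f20 subr0.
apply: (gen_eigen_coprime lX (r := [seq b <- r | b != a]) (a := a)).
- by rewrite fv2; apply: (gen_eigen_submod lX a).2.
- by rewrite -(partial_map_shifts _ sS pf v2S) v2r f0.
- by rewrite mem_filter eqxx.
Qed.

Lemma ex_weight_vector A (w : A) : is_gen_module A -> w != 0 ->
  exists a x, x \in @weight_space R V A a /\ x != 0.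
Proof.
move=> gA; apply: contra_neqP => no.
have [g [[gW _ ->] _]] := gm_grading gA w; apply: fsbig1 => a _.
by apply/eqP/negPn/negP => ga; apply: no; exists a, (g a).
Qed.

Lemma irreducible_cyc X (w : X) : irreducible_module X -> w != 0 -> cyc w = full_sub X.
Proof.
move=> irX w0; have [[gX _ _] _] := irX.
case: (irreducible_stable irX (@cyc_stable _ _ _ gX w)) => // E.
by have := mem_cyc gX w; rewrite E => /in_zero/eqP; rewrite (negPf w0).
Qed.

(** [X] is generated by [x], so its weights lie in [a] plus the integers; lower truncation bounds
    the [k] for which [a - k] is a weight, and the largest gives [n0]. *)
Lemma irreducible_weight X a (x : X) : irreducible_module X ->
  x \in @weight_space R V X a -> x != 0 ->
  exists n0 (k : nat), lowest_weight X n0 /\ a = n0 + k%:R.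
Proof.
move=> irX xa x0; have [[gX [[B BP] _] _] _] := irX.
pose P (k : nat) := exists2 y : X, y \in @weight_space R V X (a - k%:R) & y != 0.
have P0 : exists k, P k by exists 0%N, x; rewrite ?subr0.
have Pbound k : P k -> (k <= Num.truncn (`|complex.Re a - B|)%R)%N.
  move=> [y yk y0]; rewrite -ltnS -(ltr_nat R).
  rewrite (le_lt_trans _ (truncnS_gt _)) //.
  have : ~ complex.Re (a - k%:R) < B by move=> /BP/(_ yk)/eqP; rewrite (negPf y0).
  move/negP; rewrite -leNgt ReD -[k%:R]/(k%:~R) -rmorphN Re_int /= rmorphN /=.
  by rewrite lerBrDl addrC -lerBrDl => /le_trans; apply; rewrite ler_norm.
have [k [y yk y0] kmax] := ex_max_nat P0 Pbound.
exists (a - k%:R), k; rewrite subrK; split=> //; split; first by exists y.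
move=> n nk w wn; apply/eqP/negPn/negP => w0.
have wcyc : w \in cyc x by rewrite irreducible_cyc ?in_full.
have [j nE] := cyc_weight gX xa wcyc wn w0.
have jk : (- k%:Z <= j)%R.
  rewrite leNgt; apply/negP => jk.
  suff : (absz j <= k)%N by lia.
  apply: kmax; exists w => //; rewrite -[(absz j)%:R]/((absz j)%:Z%:~R) -rmorphN /=.
  by rewrite (_ : - _ = j) -?nE //; lia.
have Rj : complex.Re n = complex.Re a + j%:~R by rewrite nE ReD Re_int.
have Rk : complex.Re (a - k%:R) = complex.Re a + (- k%:Z)%:~R.
  by rewrite ReD -[k%:R]/(k%:~R) -rmorphN Re_int.
case: nk; rewrite Rj Rk.
  by rewrite ltrD2l ltr_int ltNge jk.
by move=> [/addrI/intr_inj jE]; rewrite nE jE rmorphN eqxx.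
Qed.

Lemma irreducible_lowest_weight X : irreducible_module X ->
  exists n0, lowest_weight X n0.
Proof.
move=> irX; have [[gX _ _] [[w w0] _]] := irX.
have [a [x [xa x0]]] := ex_weight_vector gX w0.
by have [n0 [k [lw _]]] := irreducible_weight irX xa x0; exists n0.
Qed.

(** At the step where [x] leaves the chain, its image in the factor is nonzero of the same
    weight. *)
Lemma composition_chain_weight A l (S T : submodClosed A) a x :
  is_gen_module A -> composition_chain l S T -> x \in S -> x \notin T ->
  x \in @weight_space R V A a ->
  exists (X : action V) n0 (k : nat),
    [/\ irreducible_module X, lowest_weight X n0 & a = n0 + k%:R].
Proof.
move=> gA; elim: l S => [S -> -> //|l IH S [S' SS' S'T] xS xT xa].
have [xS'|xS'] := boolP (x \in S'); first exact: IH S'T xS' xT xa.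
have [sS [X irX [f [pf _ fker]]]] := SS'.
have fx : f x != 0 by apply: contraNneq xS' => fx; apply/fker.
have [[gX _ _] _] := irX; have [f0 _] := partial_map_lin pf.
have fxa : f x \in @weight_space R V X a.
  have [k xk] := (gen_eigenP _ _ _).1 xa; apply/gen_eigenP; exists k.
  by rewrite -(partial_map_shifts _ sS pf xS) xk f0.
have [n0 [k [lw aE]]] := irreducible_weight irX fxa fx.
by exists X, n0, k.
Qed.

(** Each factor contributes a lift of a lowest weight vector; a relation is resolved from the top,
    since the map of a factor kills all later lifts. *)
Lemma composition_chain_vectors A l (S T : submodClosed A) :
  is_gen_module A -> composition_chain l S T -> exists x : nat -> A,
    (forall i, (i < l)%N -> x i \in S /\ exists (X : action V) mu,
       [/\ irreducible_module X, lowest_weight X mu & x i \in @weight_space R V A mu]) /\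
    (forall c : nat -> R[i], \sum_(i < l) c i *: x i \in T ->
       forall i, (i < l)%N -> c i = 0).
Proof.
move=> gA; elim: l S => [S _|l IH S [S' SS' S'T]]; first by exists (fun=> 0).
have [x [xS' free]] := IH S' S'T.
have [sS [X irX [f [pf fsur fker]]]] := SS'.
have [mu lw] := irreducible_lowest_weight irX; have [[y ymu y0] _] := lw.
have [[gX _ _] _] := irX.
have [s [sS1 smu sy]] := partial_map_weight_onto gA gX sS pf fsur ymu.
have S'S := simple_step_sub SS'.
exists (fun i => if i is j.+1 then x j else s); split=> [[|i] il|c].
- by split=> //; exists X, mu.
- by have [xS X'] := xS' _ il; split=> //; apply: S'S.
rewrite big_ord_recl /=; set z := \sum_(i < l) _ => cT.
have zS' : z \in S'.
  by apply: rpred_sum => i _; apply: rpredZ; have [] := xS' i (ltn_ord i).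
have c0 : c 0%N = 0.
  have /fker[_ fcs] := composition_chain_sub S'T cT.
  have /fker[_ fz] := zS'.
  move: fcs; rewrite (pf.1 _ _ _ sS1 (S'S _ zS')) fz addr0 sy => /eqP.
  by rewrite scaler_eq0 (negPf y0) orbF => /eqP.
move: cT; rewrite c0 scale0r add0r => zT.
by case=> [//|i] il; apply: (free (fun j => c j.+1)).
Qed.

Lemma sub_action_chain A l (S : submodClosed A) (sS : stable S) :
  is_gen_module A -> composition_chain l (full_sub A) (zero_sub A) ->
  exists k, [/\ (k <= l)%N,
    composition_chain k (full_sub (sub_action sS)) (zero_sub (sub_action sS)) &
    k = l -> forall x, x \in S].
Proof.
move=> gA cA; have [k [kl ck tight]] := composition_chain_cap gA sS cA.
pose i : {linear sub_action sS -> A} := (val : subspace S -> A).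
exists k; split=> // [|kE x]; last first.
  have [y yS /in_zero/eqP] := tight kE x (in_full x).
  by rewrite subr_eq0 => /eqP ->.
have onto : {in cap_sub (full_sub A) S, forall y, exists x, i x = y}.
  by move=> y /in_cap[_ yS]; exists (Sub y yS : subspace S).
have := composition_chain_preim (f := i) (fun _ _ _ => erefl) onto ck.
rewrite (_ : preim_sub i _ = full_sub _); last first.
  apply: submod_ext => x; rewrite in_full; apply/in_preim/in_cap.
  by split; [exact: in_full | exact: valP].
rewrite (_ : preim_sub i _ = zero_sub _) //.
apply: submod_ext => x; apply/idP/idP => [/in_preim/in_cap[/in_zero x0 _]|/in_zero ->].
  by apply/in_zero/val_inj.
exact: rpred0.
Qed.

End WeightMaps.

Section LengthBound.
Variables (R : realType) (V : voa R) (N : nat).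
Hypothesis close : forall (W1 W2 : action V) (n1 n2 : R[i]),
  irreducible_module W1 -> irreducible_module W2 ->
  lowest_weight W1 n1 -> lowest_weight W2 n2 ->
  `|complex.Re n1 - complex.Re n2| <= N%:R.
Hypothesis zhuN : zhu_finite_dim V N.
Variables (W : action V) (lam : R[i]).
Hypotheses (irW : irreducible_module W) (lwW : lowest_weight W lam).

(** Each weight of [M] exceeds by a natural number some lowest weight, which lies within [N] of
    [mu]. *)
Lemma chain_no_weight_below (M : action V) l (X : action V) mu : is_gen_module M ->
  composition_chain l (full_sub M) (zero_sub M) ->
  irreducible_module X -> lowest_weight X mu ->
  no_weight_below M (complex.Re mu - N%:R).
Proof.
move=> gM cM irX lwX n w wn; apply: contraTeq => w0; rewrite -leNgt.
have [|Y [n0 [k [irY lwY ->]]]] := composition_chain_weight gM cM (in_full w) _ wn.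
  by apply: contra w0 => /in_zero ->.
have := close irX irY lwX lwY; rewrite ler_norml => /andP[_ le].
rewrite ReD -[k%:R]/(k%:~R) Re_int /=; have := ler0n R k.
by rewrite -[k%:~R]/(k%:R); lra.
Qed.

(** Only those [lam + j] that are lowest weights are counted: [close] then forbids weights more than
    [N] below [lam + j], as raising requires. For lowering, [W] itself supplies the bound below
    [lam]. *)
Lemma weight_multiplicity_bound (j : int) : exists D : nat,
  forall (M : action V) (m : M) l, is_gen_module M ->
    m \in @weight_space R V M lam -> cyc m = full_sub M ->
    composition_chain l (full_sub M) (zero_sub M) ->
    spanned_by D (fun w => w \in @weight_space R V M (lam + j%:~R) /\
      exists2 X : action V, irreducible_module X & lowest_weight X (lam + j%:~R)).
Proof.
have [[D DP] [E EP]] := (raised_bound zhuN (absz j), lowered_bound zhuN (absz j)).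
exists (D + E)%N => M m l gM mlam cM chain.
have [[X irX lwX]|no] := pselect (exists2 X : action V,
  irreducible_module X & lowest_weight X (lam + j%:~R)); last first.
  by exists [::]; split=> // w [_ /no].
have low := chain_no_weight_below gM chain irX lwX.
have [j0|j0] := lerP 0 j.
  have jE : j%:~R = (absz j)%:R :> R[i] by rewrite -[RHS]/((absz j)%:Z%:~R) gez0_abs.
  have [|s [sD sP]] := DP M lam m gM mlam.
    by move: low; rewrite ReD Re_int -[(absz j)%:R]/((absz j)%:Z%:~R) gez0_abs.
  exists s; split; first exact: leq_trans sD (leq_addr _ _).
  by move=> w [wj _]; apply: sP; rewrite cM in_full -jE.
have jE : j%:~R = - (absz j)%:R :> R[i].
  by rewrite -[(absz j)%:R]/((absz j)%:Z%:~R) -rmorphN /= ltz0_abs // opprK.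
have [|s [sD sP]] := EP M lam m gM mlam.
  exact: chain_no_weight_below gM chain irW lwW.
exists s; split; first exact: leq_trans sD (leq_addl _ _).
by move=> w [wj _]; apply: sP; rewrite cM in_full -jE.
Qed.

Lemma length_bound : exists D : nat,
  forall (M : action V) (m : M) l, is_gen_module M ->
    m \in @weight_space R V M lam -> cyc m = full_sub M ->
    composition_chain l (full_sub M) (zero_sub M) -> (l <= D)%N.
Proof.
(* The integers from [-N] to [N]. *)
pose js := [seq i%:Z - N%:Z | i <- iota 0 (N + N).+1].
suff [D DP] : exists D : nat,
  forall (M : action V) (m : M) l, is_gen_module M ->
    m \in @weight_space R V M lam -> cyc m = full_sub M ->
    composition_chain l (full_sub M) (zero_sub M) ->
    spanned_by D (fun w => exists j : int,
      [/\ j \in js, w \in @weight_space R V M (lam + j%:~R) &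
      exists2 X : action V, irreducible_module X & lowest_weight X (lam + j%:~R)]).
  exists D => M m l gM mlam cM chain.
  have [s [sD sP]] := DP M m l gM mlam cM chain.
  have [x [xP free]] := composition_chain_vectors gM chain.
  apply: leq_trans sD; apply: (independent_size (x := x)) => [i il|c c0]; last first.
    by apply: free; rewrite c0 rpred0.
  (* [cyc_weight] needs a nonzero vector to place its weight in [lam] plus the integers. *)
  have x0 : x i != 0.
    apply/eqP => x0; have := free (fun j => (j == i)%:R) _ i il; rewrite eqxx.
    suff -> : \sum_(j < l) (val j == i)%:R *: x j = 0.
      by rewrite rpred0 => /(_ isT)/eqP; rewrite oner_eq0.
    apply: big1 => j _; case: eqP => [->|_]; first by rewrite x0 scaler0.
    by rewrite scale0r.
  have [_ [X [mu [irX lwX xmu]]]] := xP i il.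
  have [|j muE] := cyc_weight gM mlam _ xmu x0; first by rewrite cM in_full.
  apply: sP; exists j; rewrite -muE; split=> //; last by exists X.
  have := close irX irW lwX lwW.
  rewrite muE ReD Re_int [complex.Re lam + _]addrC addrK.
  rewrite -intr_norm -[N%:R]/(N%:~R) ler_int => jN.
  apply/mapP; exists (absz (j + N%:Z)%R); last by lia.
  by rewrite mem_iota; lia.
elim: js => [|j js [D DP]].
  by exists 0%N => M m l *; exists [::]; split=> // w [i []].
have [E EP] := weight_multiplicity_bound j.
exists (E + D)%N => M m l gM mlam cM chain.
have [s [sD sP]] := spanned_by_cat (EP M m l gM mlam cM chain) (DP M m l gM mlam cM chain).
exists s; split=> // w [k]; rewrite inE => -[/orP[/eqP ->|kjs] wk X]; apply: sP.
  by left.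
by right; exists k.
Qed.

End LengthBound.

(** * The universal finite length module on a vector of given weight *)

Section UniversalModule.
Variables (R : realType) (V : voa R) (lam : R[i]) (D : nat).

Definition generated_length (M : gen_module V) (m : M) (l : nat) : Prop :=
  [/\ m \in @weight_space R V M lam, cyc m = full_sub M
    & composition_chain l (full_sub M) (zero_sub M)].

Hypothesis bounded : forall (M : gen_module V) (m : M) l,
  generated_length m l -> (l <= D)%N.

(* The pair [(m, m')] generates a submodule of [M * M'] that maps onto [M];
   by maximality of the length of [M] the kernel is zero, so that this
   submodule is the graph of a map. *)
Lemma universal_map (M : gen_module V) (m : M) l (M' : gen_module V) (m' : M') l' :
  generated_length m l ->
  (forall (M2 : gen_module V) (m2 : M2) k, generated_length m2 k -> (k <= l)%N) ->
  composition_chain l' (full_sub M') (zero_sub M') ->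
  m' \in @weight_space R V M' lam ->
  exists2 f : {linear M -> M'}, module_map f & f m = m'.
Proof.
move=> [mlam cM chM] lmax chM' m'lam.
have gM := gm_axioms M; have gM' := gm_axioms M'.
have gP := prod_action_gen gM gM'; set P := prod_action M M' in gP.
pose p1 : {linear P -> M} := (fst : M * M' -> M).
pose p2 : {linear P -> M'} := (snd : M * M' -> M').
have mp1 : module_map p1 by []. have mp2 : module_map p2 by [].
have p_inj x : p1 x = 0 -> p2 x = 0 -> x = 0 by case: x => x y /= -> ->.
pose e : P := (m, m').
have elam : e \in @weight_space R V P lam.
  exact: (weight_inj gM gM' mp1 mp2 p_inj).
pose sC := @cyc_stable R V P gP e.
pose E := GenModule (sub_action_gen sC gP).
have gE := gm_axioms E.
pose i : {linear E -> P} := (val : subspace (cyc e) -> P).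
have mi : module_map i by [].
have i_inj x : i x = 0 -> x = 0 by move=> ix; apply: val_inj.
pose e' : E := Sub e (mem_cyc gP e) : subspace (cyc e).
have e'lam : e' \in @weight_space R V E lam.
  by apply: (weight_inj (f := i) (g := i) gP gP) => // x /i_inj.
have cE : cyc e' = full_sub E.
  apply: submod_ext => x; rewrite in_full.
  have : val x \in im_sub i (cyc e').
    apply: (cyc_min (m := e)) (valP x); first by apply: im_stable => //; apply: cyc_stable.
    by apply/in_im; exists e'; [exact: mem_cyc|].
  by move=> /in_im[y yE /val_inj <-].
have [n chP] := prod_chain gM gM' chM chM'.
have [k [_ chE _]] := sub_action_chain sC gP chP.
pose q : {linear E -> M} := p1 \o i.
have mq : module_map q by [].
have onto y : exists x, q x = y.
  have : y \in im_sub q (full_sub E).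
    have : y \in cyc m by rewrite cM in_full.
    apply: cyc_min; first by apply: im_stable => //; apply: full_stable.
    by apply/in_im; exists e'; rewrite ?in_full.
  by move=> /in_im[x _ <-]; exists x.
have onto' : {in full_sub M, forall y, exists x, q x = y} by move=> y _.
have ch1 := composition_chain_preim mq onto' chM.
have sK := preim_stable mq (zero_stable gM).
have [k' [_ ch2 _]] := composition_chain_cap gE sK chE.
have EK : cap_sub (full_sub E) (preim_sub q (zero_sub M)) = preim_sub q (zero_sub M).
  apply: submod_ext => x; apply/idP/idP => [/in_cap[] //|xK].
  by apply/in_cap; rewrite in_full.
have E0 : cap_sub (zero_sub E) (preim_sub q (zero_sub M)) = zero_sub E.
  apply: submod_ext => x; apply/idP/idP => [/in_cap[] //|/in_zero ->].
  exact: rpred0.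
have EF : preim_sub q (full_sub M) = full_sub E.
  by apply: submod_ext => x; rewrite in_full; apply/in_preim/in_full.
rewrite EK E0 in ch2; rewrite EF in ch1.
(* [E] has a chain of length [l + k'], where [k'] counts the steps inside the kernel of [q];
   maximality of [l] leaves none. *)
have k'0 : k' = 0%N.
  have := lmax E e' (l + k')%N (And3 e'lam cE (composition_chain_cat ch1 ch2)).
  by lia.
have q_inj x : q x = 0 -> x = 0.
  by move=> qx; apply/in_zero; rewrite k'0 in ch2; rewrite -ch2; apply/in_preim/in_zero.
pose r (x : M) (y : M') := exists2 z : E, q z = x & p2 (i z) = y.
have rtot x : exists y, r x y by have [z zx] := onto x; exists (p2 (i z)), z.
have r0 y : r 0 y -> y = 0 by move=> [z /q_inj -> <-]; rewrite !linear0.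
have rD a x y x' y' : r x y -> r x' y' -> r (a *: x + x') (a *: y + y').
  by move=> [z <- <-] [z' <- <-]; exists (a *: z + z'); rewrite !linearP.
have [f fP] := linear_of_rel rtot r0 rD.
exists f; last by apply/fP; exists e'.
move=> u j x; have [z zx] := onto x; apply/fP; exists (act_Y u j z).
  by rewrite mq zx.
by rewrite mi mp2; congr act_Y; symmetry; apply/fP; exists z.
Qed.

Lemma ex_projective (W : gen_module V) (w : W) :
  irreducible_module W -> w \in @weight_space R V W lam -> w != 0 ->
  exists (P : gen_module V) (p : {linear P -> W}),
    projective (@finite_length R V) P /\ surjective_map p.
Proof.
move=> irW wlam w0; have gW := gm_axioms W.
have chW := irreducible_chain irW.
(* The maximum exists: [W] with [w] is a generated pair of length 1, and [D] bounds all lengths. *)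
have [|l k_le|l [P [m gen]] lmax] := @ex_max_nat
  (fun l => exists (M : gen_module V) (m : M), generated_length m l) D.
- by exists 1%N, W, w; split=> //; apply: irreducible_cyc.
- by case: k_le => M [m]; apply: bounded.
have univ M' (m' : gm_action M') l' :=
  @universal_map P m l M' m' l' gen (fun M2 m2 k g => lmax k (ex_intro _ M2 (ex_intro _ m2 g))).
have [mlam cP chP] := gen; have gP := gm_axioms P.
have [p mp pm] := univ W w 1%N chW wlam.
exists P, p; split; last first.
  split=> // y; have : y \in im_sub p (full_sub P).
    have : y \in cyc w by rewrite irreducible_cyc ?in_full.
    apply: cyc_min; first by apply: im_stable => //; apply: full_stable.
    by apply/in_im; exists m; rewrite ?in_full.
  by move=> /in_im[x _ <-]; exists x.
split; first by exists l; apply/has_lengthP.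
move=> W1 W2 f q [l1 /has_lengthP ch1] _ mf [mq sq].
have gW1 := gm_axioms W1; have gW2 := gm_axioms W2.
have fmlam := weight_map mf mlam.
have pq : partial_map (full_sub W1) q by split=> [a x y _ _|u n x _]; rewrite ?linearP ?mq.
have onto y : exists2 x, x \in full_sub W1 & q x = y.
  by have [x <-] := sq y; exists x; rewrite ?in_full.
(* A lift of [f m] of the same weight is a legitimate image of the universal vector [m]. *)
have [x [_ xlam qx]] := partial_map_weight_onto gW1 gW2 (@full_stable _ _ W1) pq onto fmlam.
have [g mg gm] := univ W1 x l1 (ch1 gW1) xlam.
exists g => // y; have : y \in cyc m by rewrite cP in_full.
(* Both maps agree on the generator [m], so the kernel of their difference is everything. *)
pose d : {linear P -> W2} := (q \o g) \- f.
move=> ym; have : y \in preim_sub d (zero_sub W2).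
  apply: cyc_min ym.
    apply: preim_stable; last exact: zero_stable.
    by move=> u n z; rewrite /= mg mq mf act_YB.
  by apply/in_preim/in_zero; rewrite /= gm qx subrr.
by move=> /in_preim/in_zero/eqP; rewrite /= subr_eq0 => /eqP.
Qed.

End UniversalModule.

(** * Projective covers *)

Section Fitting.
Variables (R : realType) (V : voa R) (U : action V) (h : {linear U -> U}).
Hypotheses (gU : is_gen_module U) (mh : module_map h).
Variable l : nat.
Hypothesis chU : composition_chain l (full_sub U) (zero_sub U).

(** The least length of a chain serves as the length, so that no comparison between different chains
    of one submodule is required. *)
Definition min_length (S : submodClosed U) (k : nat) : Prop :=
  composition_chain k S (zero_sub U) /\
  forall j, composition_chain j S (zero_sub U) -> (k <= j)%N.

Lemma cap_chain (S T : submodClosed U) k : stable T -> {subset T <= S} ->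
  composition_chain k S (zero_sub U) ->
  exists j, [/\ (j <= k)%N, composition_chain j T (zero_sub U)
    & j = k -> {subset S <= T}].
Proof.
move=> sT TS chS; have [j [jk chj tight]] := composition_chain_cap gU sT chS.
have E0 : cap_sub (zero_sub U) T = zero_sub U.
  apply: submod_ext => x; apply/idP/idP => [/in_cap[] //|/in_zero ->].
  exact: rpred0.
have ES : cap_sub S T = T.
  apply: submod_ext => x; apply/idP/idP => [/in_cap[] //|xT].
  by apply/in_cap; split=> //; apply: TS.
rewrite E0 ES in chj; exists j; split=> // /tight H x /H[y yT /in_zero/eqP].
by rewrite subr_eq0 => /eqP ->.
Qed.

Lemma ex_min_length (S : submodClosed U) : stable S ->
  exists2 k, min_length S k & (k <= l)%N.
Proof.
move=> sS; have [|j [jl chj _]] := cap_chain sS _ chU.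
  by move=> x _; apply: in_full.
have [k chk kmin] := ex_min_nat (ex_intro (fun k => composition_chain k S (zero_sub U)) j chj).
by exists k => //; apply: leq_trans jl; apply: kmin.
Qed.

Lemma min_length_sub (S T : submodClosed U) a b : stable T -> {subset T <= S} ->
  min_length S a -> min_length T b -> (b <= a)%N /\ (b = a -> {subset S <= T}).
Proof.
move=> sT TS [chS _] [_ bmin]; have [j [ja chj tight]] := cap_chain sT TS chS.
have bj := bmin j chj; split=> [|ba]; first exact: leq_trans ja.
by apply: tight; apply/eqP; rewrite eqn_leq ja -ba.
Qed.

Lemma iter_linear n : linear (iter n h).
Proof. by elim: n => [//|n IH] a x y; rewrite /= IH linearP. Qed.

Lemma iter_module n u j x : iter n h (act_Y u j x) = act_Y u j (iter n h x).
Proof. by elim: n => [//|n IH]; rewrite /= IH mh. Qed.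

Lemma iter_ker n : {T : submodClosed U | forall x, x \in T <-> iter n h x = 0}.
Proof.
apply: subspace_of => [|a x y x0 y0]; first exact: (linear_at0 (iter_linear n)).
by rewrite iter_linear x0 y0 scaler0 addr0.
Qed.

Lemma iter_im n : {T : submodClosed U | forall y, y \in T <-> exists x, iter n h x = y}.
Proof.
apply: subspace_of => [|a _ _ [x <-] [y <-]].
  by exists 0; apply: (linear_at0 (iter_linear n)).
by exists (a *: x + y); rewrite iter_linear.
Qed.

Let K n := sval (iter_ker n).
Let I n := sval (iter_im n).
Let inK n x : x \in K n <-> iter n h x = 0 := svalP (iter_ker n) x.
Let inI n y : y \in I n <-> exists x, iter n h x = y := svalP (iter_im n) y.

Let sK n : stable (K n).
Proof. by move=> u j x /inK x0; apply/inK; rewrite iter_module x0 act_Y0. Qed.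

Let sI n : stable (I n).
Proof.
by move=> u j _ /inI[x <-]; apply/inI; exists (act_Y u j x); rewrite iter_module.
Qed.

Let K_sub n m : (n <= m)%N -> {subset K n <= K m}.
Proof.
move=> nm x /inK x0; apply/inK; rewrite -(subnK nm) iterD x0.
exact: (linear_at0 (iter_linear _)).
Qed.

Let I_sub n m : (n <= m)%N -> {subset I m <= I n}.
Proof.
move=> nm _ /inI[x <-]; apply/inI; rewrite -(subnKC nm) iterD.
by exists (iter (m - n) h x).
Qed.

(** The two clauses say that image and kernel of the power span [U] and meet in zero. *)
Lemma fitting : exists n,
  [/\ forall x, exists y, iter n.+1 h (x - iter n.+1 h y) = 0
    & forall x, iter n.+1 h (iter n.+1 h x) = 0 -> iter n.+1 h x = 0].
Proof.
(* The images decrease and the kernels increase; they stabilize where the minimal length is least,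
   respectively greatest. *)
have [|a [n0 an0] amin] := @ex_min_nat (fun k => exists n, min_length (I n) k).
  by have [k ik _] := ex_min_length (@sI 0); exists k, 0%N.
have [||b [n1 bn1] bmax] := @ex_max_nat (fun k => exists n, min_length (K n) k) l.
- by have [k ik _] := ex_min_length (@sK 0); exists k, 0%N.
- move=> k [n [_ kmin]]; have [j [chj _] jl] := ex_min_length (@sK n).
  exact: leq_trans (kmin _ chj) jl.
have Istab n : (n0 <= n)%N -> {subset I n0 <= I n}.
  move=> nn; have [c cn _] := ex_min_length (@sI n).
  have [ca] := min_length_sub (@sI n) (I_sub nn) an0 cn; apply.
  by apply/eqP; rewrite eqn_leq ca amin //; exists n.
have Kstab n : (n1 <= n)%N -> {subset K n <= K n1}.
  move=> nn; have [c cn _] := ex_min_length (@sK n).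
  have [bc] := min_length_sub (@sK n1) (K_sub nn) cn bn1; apply.
  by apply/eqP; rewrite eqn_leq bc bmax //; exists n.
(* The exponent is a successor so that [h^(n+1) y = f (g (h^n y))] can later exhibit preimages under
   [f]. *)
exists (n0 + n1)%N; set n := (n0 + n1).+1.
have n0n : (n0 <= n)%N by rewrite /n; lia.
have n1n : (n1 <= n)%N by rewrite /n; lia.
split=> [x|x].
  have : iter n h x \in I (n + n).
    by apply: Istab; [lia|apply: I_sub n0n _ _; apply/inI; exists x].
  move=> /inI[y]; rewrite iterD => yx; exists y.
  by rewrite addrC -scaleN1r iter_linear yx scaleN1r addNr.
rewrite -iterD => x0; apply/inK; apply: (K_sub n1n); apply: (Kstab (n + n)%N); first lia.
exact/inK.
Qed.

End Fitting.

Section ProjectiveCover.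
Variables (R : realType) (V : voa R).
Local Notation D := (@finite_length R V).

(* A projective [U] over [W] of least length is a cover: Fitting's lemma splits
   off the image of a power of an endomorphism of [U] over [W], and that
   projective summand still covers [W], so it is all of [U]. *)
Lemma has_projective_cover_of (W : gen_module V) : finite_length W ->
  (exists (P : gen_module V) (p : {linear P -> W}), projective D P /\ surjective_map p) ->
  has_projective_cover D W.
Proof.
move=> flW [P0 [p0 [projP0 surP0]]].
pose Q l := exists (U : gen_module V) (p : {linear U -> W}),
  [/\ projective D U, surjective_map p & has_length U l].
have [|l [U [p [projU [mp sp] lenU]]] lmin] := @ex_min_nat Q.
  by have [[l len] _] := projP0; exists l, P0, p0.
exists U, p; split=> // W1 q projW1 [mq sq].
have [f mf pf] := projW1.2 U W q p projU.1 flW mq (conj mp sp).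
have [g mg qg] := projU.2 W1 W p q projW1.1 flW mp (conj mq sq).
exists f => //; split=> //.
pose h : {linear U -> U} := f \o g.
have mh : module_map h by move=> u j x; rewrite /= mg mf.
have ph x : p (h x) = p x by rewrite /= pf qg.
have gU := gm_axioms U; have chU := (has_lengthP l gU).1 lenU.
have [n [dec inj]] := fitting gU mh chU.
pose hn := iter n.+1 h.
have hlin : linear hn := iter_linear h n.+1.
have hB x y : hn (x - y) = hn x - hn y.
  by rewrite addrC -scaleN1r hlin scaleN1r addrC.
have hm u j x : hn (act_Y u j x) = act_Y u j (hn x) := iter_module mh n.+1 u j x.
have phn x : p (hn x) = p x.
  by rewrite /hn; elim: n.+1 {dec inj hlin hB hm} => [//|k IH]; rewrite /= -/(h _) ph.
have [I inI] := iter_im h n.+1.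
have sI : stable I.
  by move=> u j _ /inI[x <-]; apply/inI; exists (act_Y u j x); apply: hm.
pose U' := GenModule (sub_action_gen sI gU).
have [k [kl chk ktop]] := sub_action_chain sI gU chU.
pose i : {linear U' -> U} := (val : subspace I -> U).
have mi : module_map i by [].
(* The graph of the projection onto [I] along the kernel of the power of [h]: existence comes from
   [dec], uniqueness from [inj]. *)
pose r (x : U) (y : U') := hn (x - i y) = 0.
have rtot x : exists y, r x y.
  have [y xy] := dec x.
  have yI : hn y \in I by apply/inI; exists y.
  by exists (Sub (hn y) yI : subspace I).
have r0 y : r 0 y -> y = 0.
  have /inI[x xy] := valP (y : subspace I).
  have {}xy : hn x = i y by [].
  rewrite /r -xy hB (linear_at0 hlin) sub0r => /eqP.
  by rewrite oppr_eq0 => /eqP/inj x0; apply: val_inj; rewrite /= -[LHS]xy.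
have rD a x y x' y' : r x y -> r x' y' -> r (a *: x + x') (a *: y + y').
  move=> xy xy'; rewrite /r linearP opprD addrACA -scalerBr.
  by rewrite hlin xy xy' scaler0 addr0.
have [pi piP] := linear_of_rel rtot r0 rD.
have mpi : module_map pi.
  move=> u j x; apply/piP; rewrite /r mi -act_YB // hm.
  by rewrite ((piP x _).2 erefl) act_Y0.
have pii y : pi (i y) = y by apply/piP; rewrite /r subrr (linear_at0 hlin).
(* A retract of a projective object: lift after [pi], then restrict along [i]. *)
have projU' : projective D U'.
  split; first by exists k; apply/has_lengthP => //; apply: sub_action_gen.
  move=> M1 M2 s t flM1 flM2 ms [mt st].
  pose s' : {linear U -> M2} := s \o pi.
  have ms' : module_map s' by move=> u j x; rewrite /= mpi ms.
  have [w mw tw] := projU.2 M1 M2 s' t flM1 flM2 ms' (conj mt st).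
  pose w' : {linear U' -> M1} := w \o i.
  exists w'; first by move=> u j x; rewrite /w' /= mw.
  by move=> x; rewrite /w' /= tw /s' /= pii.
have surp : surjective_map (p \o i : {linear U' -> W}).
  split=> [u j x|y]; first by rewrite /= mp.
  have [x <-] := sp y; have xI : hn x \in I by apply/inI; exists x.
  by exists (Sub (hn x) xI : subspace I); rewrite /= phn.
have lk : (l <= k)%N.
  apply: lmin; exists U', (p \o i); split=> //.
  by apply/has_lengthP => //; apply: sub_action_gen.
(* Minimality of [l] forces the summand to be all of [U], so every vector is a value of [h^(n+1)],
   hence of [f]. *)
have top := ktop (anti_leq (introT andP (conj kl lk))).
by move=> x; have /inI[y <-] := top x; exists (g (iter n h y)).
Qed.

End ProjectiveCover.

Theorem theorem3p23 (R : realType) (V : voa R)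
    (hC1 : C1_cofinite V)
    (hN : exists N : nat,
        [/\ (0 < N)%N,
            forall (W1 W2 : action V) (n1 n2 : R[i]),
              irreducible_module W1 -> irreducible_module W2 ->
              lowest_weight W1 n1 -> lowest_weight W2 n2 ->
              `|complex.Re n1 - complex.Re n2| <= N%:R &
            zhu_finite_dim V N])
    (W : gen_module V) (hW : irreducible_module W) :
  has_projective_cover (@finite_length R V) W.
Proof.
have [N [_ close zhuN]] := hN.
have [lam lw] := irreducible_lowest_weight hW; have [[w wlam w0] _] := lw.
have [D DP] := length_bound close zhuN hW lw.
apply: has_projective_cover_of.
  exists 1%N; apply/has_lengthP; first exact: gm_axioms.
  exact: irreducible_chain.
apply: (ex_projective (lam := lam) (D := D) _ hW wlam w0) => M m l [mlam cM chM].
by apply: DP mlam cM chM; apply: gm_axioms.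
Qed.
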